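(* Let $\nu$ be a probability measure on $\mathbb{R}$ with Stieltjes transform $G_\nu(z) = \int\frac{1}{z-x}\,\nu(dx)$. Then there exists a probability measure $\tilde\nu$ on $\mathbb{R}$ (depending only on $\nu$) such that $$G_{\tilde\nu}(z) = \frac{[G_\nu(z)]^{1/2}}{z^{1/2}}\qquad\text{for all } z \text{ with } \Im(z)>0,$$ and the following holds: if $\lambda>0$ and $\mu$ is a probability measure supported in $[-1,1]$ such that $$\int \frac{1}{(z-x)^{\lambda/2}}\,\mu(dx) = [G_\nu(z)]^{\lambda/2}\qquad\text{for all } z \text{ with } \Im(z)>0,$$ then $$\int \frac{1}{(z-x)^{\lambda}}\,(\kappa_\lambda\star\mu)(dx) = \left[\frac{[G_\nu(z)]^{1/2}}{z^{1/2}}\right]^{\lambda} = [G_{\tilde\nu}(z)]^{\lambda}\qquad\text{for all } z \text{ with } \Im(z)>0.$$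
   Context: For $\lambda>0$, $\kappa_\lambda$ is the probability measure on $[0,1]$ with density $\frac{\Gamma(\lambda)}{[\Gamma(\lambda/2)]^2}[x(1-x)]^{(\lambda/2)-1}\mathbf{1}_{[0,1]}(x)$. $\kappa_\lambda\star\mu$ denotes the multiplicative convolution, i.e. the law of the product of two independent random variables with laws $\kappa_\lambda$ and $\mu$: $\int f(x)\,(\kappa_\lambda\star\mu)(dx) = \iint f(uv)\,\kappa_\lambda(du)\,\mu(dv)$ for bounded measurable $f$. All powers are principal powers (for $\Im(z)>0$ one has $\Im G_\nu(z)<0$). *)

(* Defs.v *)
(* MathComp-Analysis over an abstract realType R; complex numbers are R[i].
   complex.Re and complex.Im are R-valued; the unqualified Re and Im are those
   of numClosedFieldType, valued in R[i]. *)
From HB Require Import structures.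
From mathcomp Require Export all_boot all_order all_algebra.
From mathcomp Require Export all_classical all_reals all_analysis.
From mathcomp Require Export measurable_realfun.
From mathcomp Require Export complex.

Set Implicit Arguments.
Unset Strict Implicit.
Unset Printing Implicit Defensive.
Import Order.TTheory GRing.Theory Num.Theory.
Import numFieldNormedType.Exports.

Local Open Scope classical_set_scope.
Local Open Scope ring_scope.
Local Open Scope complex_scope.

(* Principal argument, in ]-pi, pi] for z != 0. *)
Definition carg (R : realType) (z : R[i]) : R :=
  let theta := acos (complex.Re z / complex.Re `|z|) in
  if 0 <= complex.Im z then theta else - theta.

(* Principal power z^a = exp (a Log z) with a real exponent, in polar form;
   the modulus `|z| lives in R[i], hence the Re.  Convention: 0^a is 0 for
   a != 0 and 1 for a = 0. *)
Definition cpow (R : realType) (z : R[i]) (a : R) : R[i] :=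
  (complex.Re `|z| `^ a)%:C * (cos (a * carg z) +i* sin (a * carg z)).

(* Integral of a complex-valued function, taken componentwise. *)
Definition cintegral d (T : measurableType d) (R : realType)
    (m : {measure set T -> \bar R}) (f : T -> R[i]) : R[i] :=
  (\int[m]_x complex.Re (f x)) +i* (\int[m]_x complex.Im (f x)).

Definition stieltjes (R : realType) (nu : probability (measurableTypeR R) R)
    (z : R[i]) : R[i] :=
  cintegral nu (fun x => 1 / (z - x%:C)).

(* Euler's integral, meaningful for 0 < s. *)
Definition Gamma (R : realType) (s : R) : R :=
  \int[lebesgue_measure]_(t in `]0, +oo[) (t `^ (s - 1) * expR (- t)).

(* At x = 0 and x = 1, powR gives 0 rather than +oo when lambda < 2; this is a
   Lebesgue-null set. *)
Definition kappa_pdf (R : realType) (lambda : R) : R -> R :=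
  (fun x => Gamma lambda / Gamma (lambda / 2) ^+ 2
            * (x * (1 - x)) `^ (lambda / 2 - 1)) \_ `[0, 1].

Definition kappa (R : realType) (lambda : R) : set (measurableTypeR R) -> \bar R :=
  fun A => (\int[lebesgue_measure]_(x in A) (kappa_pdf lambda x)%:E)%E.

Section kappa_measure.
Context (R : realType) (lambda : R).

Lemma Gamma_ge0 (s : R) : 0 <= Gamma s.
Proof.
apply: Rintegral_ge0 => t _.
by rewrite mulr_ge0 ?powR_ge0 ?expR_ge0.
Qed.

Lemma kappa_pdf_ge0 x : 0 <= kappa_pdf lambda x.
Proof.
rewrite /kappa_pdf patchE; case: ifPn => // _.
by rewrite mulr_ge0 ?powR_ge0 ?divr_ge0 ?exprn_ge0 ?Gamma_ge0.
Qed.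

Lemma measurable_kappa_pdf : measurable_fun setT (kappa_pdf lambda).
Proof.
apply/measurable_restrict => //; rewrite setTI; apply: measurable_funTS.
apply: measurable_funM => //.
apply: (measurableT_comp (f := @powR R ^~ (lambda / 2 - 1))) => //.
by apply: measurable_funM => //; exact: measurable_funB.
Qed.

Let kappa0 : kappa lambda set0 = 0%E.
Proof. by rewrite /kappa integral_set0. Qed.

Let kappa_ge0 A : (0 <= kappa lambda A)%E.
Proof. by apply: integral_ge0 => x _; rewrite lee_fin kappa_pdf_ge0. Qed.

Let kappa_sigma_additive : semi_sigma_additive (kappa lambda).
Proof.
apply: semi_sigma_additive_nng_induced => [|x].
  by apply/measurable_EFinP; exact: measurable_kappa_pdf.
by rewrite lee_fin kappa_pdf_ge0.
Qed.

HB.instance Definition _ := isMeasure.Build _ _ _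
  (kappa lambda) kappa0 kappa_ge0 kappa_sigma_additive.

End kappa_measure.

(* Law of U * V for independent U, V of laws m1, m2: the image of the product
   measure under multiplication. *)
Definition mconv (R : realType) (m1 : {measure set (measurableTypeR R) -> \bar R})
    (m2 : probability (measurableTypeR R) R) : set (measurableTypeR R) -> \bar R :=
  pushforward (m1 \x m2)%E
    (fun p : measurableTypeR R * measurableTypeR R => p.1 * p.2 : measurableTypeR R).

Section mconv_measure.
Context (R : realType) (m1 : {measure set (measurableTypeR R) -> \bar R})
  (m2 : probability (measurableTypeR R) R).

Let measurable_mul2 : measurable_fun setT
  (fun p : measurableTypeR R * measurableTypeR R => p.1 * p.2 : measurableTypeR R).
Proof. by apply: measurable_funM. Qed.

Let mconv0 : mconv m1 m2 set0 = 0%E.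
Proof. by rewrite /mconv /pushforward preimage_set0 measure0. Qed.

Let mconv_ge0 A : (0 <= mconv m1 m2 A)%E.
Proof. exact: measure_ge0. Qed.

Let mconv_sigma_additive : semi_sigma_additive (mconv m1 m2).
Proof.
move=> F mF tF mUF; rewrite /mconv /pushforward preimage_bigcup.
apply: measure_semi_sigma_additive.
- by move=> n; rewrite -[X in measurable X]setTI; exact: measurable_mul2.
- apply/trivIsetP => /= i j _ _ ij; rewrite -preimage_setI.
  by move/trivIsetP : tF => /(_ _ _ _ _ ij) ->//; rewrite preimage_set0.
- by rewrite -preimage_bigcup -[X in measurable X]setTI; exact: measurable_mul2.
Qed.

HB.instance Definition _ := isMeasure.Build _ _ _
  (mconv m1 m2) mconv0 mconv_ge0 mconv_sigma_additive.

End mconv_measure.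

(* Main.v *)
From HB Require Import structures.
From mathcomp Require Import finmap spectral.
Require Import Defs.
From mathcomp Require Import ring lra.

(** Write [G] for the Stieltjes transform of [nu] and let [Im z > 0]. The theorem
    has two independent halves.

    The integral identity rests on the kernel formula, for real [v],
      int (z - u v)^(- lambda) kappa_lambda(du) = z^(- lambda/2) (z - v)^(- lambda/2)
    ([Re_integral_kernel]). Multiply its left side by [(z - v)^(lambda/2)]: the
    derivative of the integrand with respect to [v] is then an exact derivative
    with respect to [u] of a function that vanishes at 0 and 1, so the integral
    does not depend on [v] and may be computed at [v = 0]. Integrating the formula
    against [mu] ([cintegral_mconv_kappa]) and inserting the hypothesis on [mu]
    gives [z^(- lambda/2) G(z)^(lambda/2)]. The arguments of [z] and [G(z)] lie in
    ]0, pi[ and ]-pi, 0[, so that this is the power of order [lambda] of the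
    quotient of the square roots ([cpow_quot]).

    For the existence of the second law one has to see that
    [T(z) = G(z)^(1/2) / z^(1/2)] is a Stieltjes transform. With [w = z G(z)] one
    has [z T(z) = sqrt w], the root with positive real part. If [nu] is finitely
    supported and [0 < t <= 1], then [w / ((1 - t) w + t) / z] is again the
    Stieltjes transform of a finitely supported law, the Boolean convolution power
    of exponent [t] ([boolean_power], by the spectral theorem). Averages of these
    functions of [w] over the roots of Chebyshev polynomials converge to [sqrt w]
    ([cheb_mean_sqr], [cheb_mean_cvg]). An arbitrary [nu] is a limit of finitely
    supported laws ([discretization]), so [T] is a pointwise limit of Stieltjes
    transforms of finitely supported laws. These laws are tight because
    [iy T(iy)] tends to 1 when [y] tends to infinity. Their quantile functions
    converge pointwise on ]0, 1[ along an ultrafilter, and the law of the limit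
    has Stieltjes transform [T] ([stieltjes_compactness]). *)

Set Implicit Arguments.
Unset Strict Implicit.
Unset Printing Implicit Defensive.
Import Order.TTheory GRing.Theory Num.Theory.
Import numFieldNormedType.Exports.
Local Open Scope classical_set_scope.
Local Open Scope ring_scope.
Local Open Scope complex_scope.

(** * Polar form and principal powers *)

Section complex_power.
Context (R : realType).
Implicit Types (z w : R[i]) (a b t r : R).

Definition cis t : R[i] := cos t +i* sin t.

(** The norm [`|z|] lives in [R[i]]; bounds and limits need it in [R]. *)
Definition modc z : R := complex.Re `|z|.

Lemma modcE z : modc z = Num.sqrt (complex.Re z ^+ 2 + complex.Im z ^+ 2).
Proof. by rewrite /modc normc_def. Qed.

Lemma modc_norm z : (modc z)%:C = `|z|.
Proof. by rewrite /modc normc_def. Qed.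

Lemma modc_ge0 z : 0 <= modc z.
Proof. by rewrite modcE sqrtr_ge0. Qed.

Lemma modcM z w : modc (z * w) = modc z * modc w.
Proof. by apply: (@complexI R); rewrite rmorphM /= !modc_norm normrM. Qed.

Lemma modcV z : modc z^-1 = (modc z)^-1.
Proof. by apply: (@complexI R); rewrite fmorphV /= !modc_norm normfV. Qed.

Lemma modcN z : modc (- z) = modc z.
Proof. by rewrite /modc normrN. Qed.

Lemma modcX z n : modc (z ^+ n) = modc z ^+ n.
Proof. by apply: (@complexI R); rewrite rmorphXn /= !modc_norm normrX. Qed.

Lemma modc_le_add z w : modc (z + w) <= modc z + modc w.
Proof. by rewrite -lecR rmorphD /= !modc_norm ler_normD. Qed.

Lemma modc_eq0 z : (modc z == 0) = (z == 0).
Proof.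
rewrite -[RHS]normr_eq0 -modc_norm; apply/eqP/eqP => [->//|]; exact: complexI.
Qed.

Lemma modc_gt0 z : (0 < modc z) = (z != 0).
Proof. by rewrite lt_def modc_ge0 andbT modc_eq0. Qed.

Lemma modcC r : modc r%:C = `|r|.
Proof. by rewrite modcE /= expr0n /= addr0 sqrtr_sqr. Qed.

Lemma sqr_modc z : modc z ^+ 2 = complex.Re z ^+ 2 + complex.Im z ^+ 2.
Proof. by rewrite modcE sqr_sqrtr// addr_ge0// sqr_ge0. Qed.

Lemma ler_Re_modc z : `|complex.Re z| <= modc z.
Proof. by rewrite modcE -sqrtr_sqr ler_wsqrtr// lerDl sqr_ge0. Qed.

Lemma ler_Im_modc z : `|complex.Im z| <= modc z.
Proof. by rewrite modcE -sqrtr_sqr ler_wsqrtr// lerDr sqr_ge0. Qed.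

Lemma modc_cis t : modc (cis t) = 1.
Proof. by rewrite modcE /= cos2Dsin2 sqrtr1. Qed.

Lemma cisD a b : cis (a + b) = cis a * cis b.
Proof. by apply/eqP; rewrite eq_complex /= cosD sinD eqxx addrC mulrC eqxx. Qed.

Lemma cis0 : cis 0 = 1.
Proof. by rewrite /cis cos0 sin0. Qed.

Lemma cis_neq0 t : cis t != 0.
Proof. by rewrite -modc_gt0 modc_cis. Qed.

Lemma cisN t : cis (- t) = (cis t)^-1.
Proof.
by apply: (mulfI (cis_neq0 t)); rewrite -cisD subrr cis0 divff// cis_neq0.
Qed.

(** Uniqueness of the polar form: [acos] undoes [cos] on [0, pi], and the sign
    of the imaginary part decides between [t] and [- t]. *)
Lemma carg_polar r t : 0 < r -> - pi < t <= pi -> carg (r%:C * cis t) = t.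
Proof.
move=> r0 /andP[pt tp].
have mE : complex.Re `|r%:C * cis t| = r.
  by rewrite -/(modc _) modcM modc_cis mulr1 modcC gtr0_norm.
rewrite /carg mE /= !(mul0r, subr0, addr0) mulrAC divff ?gt_eqF// mul1r pmulr_rge0//.
case: (leP 0 t) => t0.
  rewrite sin_ge0_pi ?t0// cosK// in_itv/= t0 tp //.
have -> : (0 <= sin t) = false.
  apply/negbTE; rewrite -ltNge -oppr_gt0 -sinN sin_gt0_pi//.
  by rewrite oppr_gt0 t0 ltrNl.
by rewrite cosKN ?opprK// (ltW pt) ltW.
Qed.

(** Existence of the polar form: by Pythagoras, the sine of [acos (Re z / |z|)]
    is [|Im z| / |z|]. *)
Lemma carg_def z : z != 0 ->
  [/\ - pi < carg z <= pi, z = (modc z)%:C * cis (carg z) &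
      (0 <= complex.Im z -> 0 <= carg z) /\ (complex.Im z < 0 -> carg z < 0)].
Proof.
move=> z0; have m0 : 0 < modc z by rewrite modc_gt0.
have b : -1 <= complex.Re z / modc z <= 1.
  by rewrite -ler_norml normrM normfV (ger0_norm (modc_ge0 z)) ler_pdivrMr// mul1r
     ler_Re_modc.
have mK x : modc z * (x / modc z) = x by rewrite mulrC divfK// gt_eqF.
have [/andP[t0 tp] tc] := acos_def b.
have s2 : sin (acos (complex.Re z / modc z)) = `|complex.Im z| / modc z.
  rewrite sin_acos// expr_div_n sqr_modc.
  have m2 : complex.Re z ^+ 2 + complex.Im z ^+ 2 != 0.
    by rewrite -sqr_modc expf_neq0// gt_eqF.
  have -> : 1 - complex.Re z ^+ 2 / (complex.Re z ^+ 2 + complex.Im z ^+ 2) =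
    (complex.Im z / modc z) ^+ 2.
    by rewrite expr_div_n sqr_modc; field.
  by rewrite sqrtr_sqr normrM normfV (ger0_norm (modc_ge0 z)).
rewrite /carg -/(modc z); case: (leP 0 (complex.Im z)) => i0.
  split=> //.
  - by rewrite tp andbT (lt_le_trans _ t0)// oppr_lt0 pi_gt0.
  - apply/eqP; rewrite eq_complex /= tc s2 ger0_norm// !(mul0r, subr0, addr0).
    by rewrite !mK !eqxx.
have tlt : acos (complex.Re z / modc z) < pi.
  rewrite lt_neqAle tp andbT; apply/eqP => e; move: s2; rewrite e sinpi => /esym/eqP.
  by rewrite mulf_eq0 invr_eq0 (gt_eqF m0) orbF normr_eq0 (lt_eqF i0).
have tgt : 0 < acos (complex.Re z / modc z).
  rewrite lt_neqAle t0 andbT; apply/eqP => e; move: s2; rewrite -e sin0 => /esym/eqP.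
  by rewrite mulf_eq0 invr_eq0 (gt_eqF m0) orbF normr_eq0 (lt_eqF i0).
split.
- by rewrite ltrN2 tlt (le_trans (y := 0))// ?pi_ge0// oppr_le0.
- apply/eqP; rewrite eq_complex /= cosN sinN tc s2 ltr0_norm// !(mul0r, subr0, addr0).
  by rewrite mulNr opprK !mK !eqxx.
- by rewrite oppr_lt0 tgt; split.
Qed.

Lemma carg_Im_gt0 z : 0 < complex.Im z -> 0 < carg z < pi.
Proof.
move=> i0; have z0 : z != 0 by apply: contraTneq i0 => ->; rewrite ltxx.
have [/andP[_ tp] e [/(_ (ltW i0)) t0 _]] := carg_def z0.
move: i0; rewrite {1}e /= !(mul0r, addr0) pmulr_rgt0 ?modc_gt0// => s0.
by rewrite !lt_neqAle t0 tp !andbT; apply/andP; split; apply: contraTneq s0;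
  [move=> <-; rewrite sin0 ltxx | move=> ->; rewrite sinpi ltxx].
Qed.

Lemma carg_Im_lt0 z : complex.Im z < 0 -> - pi < carg z < 0.
Proof.
move=> i0; have z0 : z != 0 by apply: contraTneq i0 => ->; rewrite ltxx.
have [/andP[tp _] e [_ /(_ i0) t0]] := carg_def z0.
by rewrite tp.
Qed.

Lemma cpowE z a : cpow z a = (modc z `^ a)%:C * cis (a * carg z).
Proof. by []. Qed.

Lemma modc_cpow z a : modc (cpow z a) = modc z `^ a.
Proof. by rewrite cpowE modcM modc_cis mulr1 modcC ger0_norm// powR_ge0. Qed.

Lemma cpow_neq0 z a : z != 0 -> cpow z a != 0.
Proof. by move=> z0; rewrite -modc_gt0 modc_cpow powR_gt0// modc_gt0. Qed.

Lemma cpowD z a b : z != 0 -> cpow z (a + b) = cpow z a * cpow z b.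
Proof.
move=> z0; rewrite !cpowE powRD; last first.
  by apply/implyP => _; rewrite modc_eq0.
by rewrite mulrDl cisD rmorphM /=; ring.
Qed.

Lemma cpow0 z : cpow z 0 = 1.
Proof. by rewrite cpowE powRr0 mul0r cis0 mulr1. Qed.

Lemma cpowN z a : z != 0 -> cpow z (- a) = (cpow z a)^-1.
Proof.
move=> z0; apply: (mulfI (cpow_neq0 a z0)).
by rewrite -cpowD// subrr cpow0 divff// cpow_neq0.
Qed.

Lemma cpow1 z : z != 0 -> cpow z 1 = z.
Proof.
move=> z0; rewrite cpowE mul1r powRr1 ?modc_ge0//.
by have [_ <- _] := carg_def z0.
Qed.

Lemma cpow_sqr z a : z != 0 -> cpow z a ^+ 2 = cpow z (a *+ 2).
Proof. by move=> z0; rewrite mulr2n cpowD// expr2. Qed.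

Lemma cpow_half_sqr z : z != 0 -> cpow z (1 / 2) ^+ 2 = z.
Proof.
by move=> z0; rewrite cpow_sqr// (_ : (1 / 2 : R) *+ 2 = 1) ?cpow1// mulr2n -splitr.
Qed.

(** The quotient [z^b / w^b] has argument [b carg z - b carg w] as long as this
    difference stays in the principal range; taking a further power is then
    multiplicative. *)
Lemma cpow_quot z w a b : z != 0 -> w != 0 ->
  - pi < b * carg z - b * carg w <= pi ->
  cpow (cpow z b / cpow w b) a = cpow z (b * a) / cpow w (b * a).
Proof.
move=> z0 w0 h.
have e : cpow z b / cpow w b =
    (modc z `^ b / modc w `^ b)%:C * cis (b * carg z - b * carg w).
  rewrite !cpowE cisD cisN invfM rmorphM /= fmorphV /=; ring.
have p0 : 0 < modc z `^ b / modc w `^ b by rewrite divr_gt0// powR_gt0 ?modc_gt0.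
rewrite [LHS]cpowE e carg_polar// modcM modc_cis modcC mulr1 gtr0_norm//.
rewrite powRM ?powR_ge0 ?invr_ge0 ?powR_ge0//.
rewrite -powRrM -powR_inv1 ?powR_ge0// -!powRrM.
rewrite mulrBr cisD cisN !cpowE invfM.
rewrite (_ : b * (-1 * a) = - (b * a)); last by ring.
rewrite powRN rmorphM /= fmorphV /=.
by rewrite !(mulrCA a b) !mulrA; ring.
Qed.

End complex_power.

(** * Integration on the line and on ]0, 1[ *)

Section lebesgue_tools.
Context (R : realType).
Notation mu := (@lebesgue_measure R).

(** Lebesgue measure is [r] times its image under [x -> r x + s], since the two
    agree on half-open intervals. *)
Lemma ge0_integral_affine (f : R -> \bar R) (r s : R) : 0 < r ->
  measurable_fun setT f -> (forall x, 0 <= f x)%E ->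
  (\int[mu]_x f x = r%:E * \int[mu]_x f (r * x + s)%R)%E.
Proof.
move=> r0 mf f0.
pose phi (x : measurableTypeR R) : measurableTypeR R := r * x + s.
have mphi : measurable_fun setT phi.
  by apply: measurable_funD => //; exact: measurable_funM.
have rnn : 0 <= r by exact: ltW.
pose pm : {measure set (measurableTypeR R) -> \bar R} := pushforward mu phi.
pose m' := mscale (NngNum rnn) (pm mphi).
have e X : ocitv X -> mu X = m' X.
  case=> -[a b] _ <-; rewrite /m' /= /mscale /= /pm /= /pushforward.
  have -> : phi @^-1` `]a, b] = `](a - s) / r, (b - s) / r]%classic.
    apply/seteqP; split=> x /=; rewrite !in_itv /= /phi;
    by rewrite ltr_pdivrMr// ler_pdivlMr// ltrBlDr lerBrDr [x * r]mulrC.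
  rewrite !lebesgue_measure_itv /= !lte_fin ltr_pM2r ?invr_gt0// ltrD2r.
  case: ifPn => _; last by rewrite mule0.
  by rewrite -!EFinD -EFinM; congr EFin; field; rewrite gt_eqF.
rewrite (eq_measure_integral (m' : {measure set (measurableTypeR R) -> \bar R})); last first.
  by move=> A mA _; exact: lebesgue_measure_unique.
rewrite ge0_integral_mscale//=; congr (_ * _)%E.
by rewrite ge0_integral_pushforward.
Qed.

Section FTC_open_unit.
Variables (f F : R -> R) (l0 l1 : R).
Hypothesis dF : forall x : R, 0 < x < 1 -> is_derive x (1 : R) F (f x).
Hypothesis cf : forall x : R, 0 < x < 1 -> {for x, continuous f}.
Hypothesis F0 : F x @[x --> 0^'+] --> l0.
Hypothesis F1 : F x @[x --> 1^'-] --> l1.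

(* The shift makes [a n < 1 - a n] hold from the first term on. *)
Let a n : R := n.+3%:R^-1.
Let J n := `[a n, 1 - a n]%classic.

Let a_gt0 n : 0 < a n. Proof. by rewrite invr_gt0. Qed.

Let a_lt n : a n < 1 - a n.
Proof.
rewrite ltrBrDr -mulr2n -mulr_natl ltr_pdivrMr// mul1r ltr_nat.
by rewrite !ltnS.
Qed.

Let J01 n x : a n <= x <= 1 - a n -> 0 < x < 1.
Proof.
move=> /andP[ax xa]; rewrite (lt_le_trans (a_gt0 n))//=.
by rewrite (le_lt_trans xa)// ltrBlDr ltrDl.
Qed.

Let cvg_a : a n @[n --> \oo] --> (0 : R).
Proof.
have := @cvg_harmonic R; rewrite -(cvg_shiftn 2) /=.
by apply: cvg_trans; apply: near_eq_cvg; near=> n; rewrite /= /a addn2.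
Unshelve. all: by end_near. Qed.

Let cF x : 0 < x < 1 -> {for x, continuous F}.
Proof.
move=> x01; apply: differentiable_continuous; apply/derivable1_diffP.
by have [] := dF x01.
Qed.

Let integral_J n :
  (\int[mu]_(x in J n) (f x)%:E = (F (1 - a n) - F (a n))%:E)%E.
Proof.
rewrite (@continuous_FTC2 _ f F) ?EFinB//.
- apply: continuous_in_subspaceT => x; rewrite inE /= in_itv /= => /J01.
  exact: cf.
- split.
  + move=> x; rewrite in_itv /= => /andP[ax xa].
    by have [] : is_derive x 1 F (f x) by apply/dF/(@J01 n); rewrite !ltW.
  + apply: cvg_at_right_filter; apply: cF.
    by apply: (@J01 n); rewrite lexx ltW.
  + apply: cvg_at_left_filter; apply: cF.
    by apply: (@J01 n); rewrite lexx ltW.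
- move=> x; rewrite in_itv /= => /andP[ax xa].
  rewrite derive1E; apply: derive_val; apply: dF.
  by apply: (@J01 n); rewrite !ltW.
Qed.

Let cvg_F : F (1 - a n) - F (a n) @[n --> \oo] --> l1 - l0.
Proof.
apply: cvgB.
- have /cvg_at_leftP := F1; apply; split=> [n|].
    by rewrite ltrBlDr ltrDl.
  rewrite -[X in _ --> X]subr0; apply: cvgB => //; exact: cvg_cst.
- by have /cvg_at_rightP := F0; apply; split=> // n.
Qed.

Let J_nd : {homo J : n m / (n <= m)%N >-> (n <= m)%O}.
Proof.
move=> n m nm; apply/subsetPset => x; rewrite /J /= !in_itv /= => /andP[ax xa].
have amn : a m <= a n by rewrite lef_pV2 ?posrE// ler_nat !ltnS.
by rewrite (le_trans amn ax) (le_trans xa)// lerB.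
Qed.

Let bigcup_J : \bigcup_n J n = `]0, 1[%classic.
Proof.
apply/seteqP; split => [x [n _]|x]; rewrite /J /= !in_itv /=; first exact: J01.
move=> /andP[x0 x1].
have m0 : 0 < Num.min x (1 - x) by rewrite lt_min x0 subr_gt0.
have /cvgr0_norm_lt /(_ _ m0) [n _ /(_ n (leqnn n))] := cvg_a.
rewrite /= (gtr0_norm (a_gt0 n)) lt_min => /andP[h1 h2].
exists n; first by [].
by rewrite /= in_itv /= (ltW h1) lerBrDr addrC -lerBrDr ltW.
Qed.

Lemma measurable_fun_open_unit : measurable_fun (`]0, 1[%classic : set R) f.
Proof.
apply: open_continuous_measurable_fun; first exact: itv_open.
by move=> x; rewrite inE /= in_itv /= => x01; apply: cf.
Qed.

Let J_sub n : J n `<=` (`]0, 1[%classic : set R).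
Proof. by rewrite -bigcup_J; exact: bigcup_sup. Qed.

(** The derivative [f] may be singular at both ends, as powers of [u] and [1 -
    u] are. The intervals [1/n, 1 - 1/n] exhaust ]0, 1[, and monotone
    convergence passes to the limit. *)
Lemma ge0_FTC_open_unit : (forall x, 0 < x < 1 -> 0 <= f x) ->
  (\int[mu]_(x in `]0%R, 1%R[) (f x)%:E = (l1 - l0)%:E)%E.
Proof.
move=> f0; apply/esym.
have h : (\int[mu]_(x in J n) (f x)%:E)%E @[n --> \oo] -->
    (\int[mu]_(x in `]0%R, 1%R[) (f x)%:E)%E.
  rewrite -bigcup_J; apply: ge0_nondecreasing_set_cvg_integral => //.
  - by move=> n; exact: measurable_itv.
  - move=> n; apply/measurable_EFinP; apply: measurable_funS (@J_sub n) _ => //.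
    exact: measurable_fun_open_unit.
  - by move=> n x; rewrite /J /= in_itv /= => /J01 /f0; rewrite lee_fin.
apply: (cvg_unique _ _ h) => //.
rewrite (_ : (fun _ => _) = EFin \o (fun n => F (1 - a n) - F (a n))).
  by apply: cvg_EFin; [exact: nearW|exact: cvg_F].
by apply/funext => n /=; rewrite integral_J.
Qed.

(** The same exhaustion, with dominated convergence. *)
Lemma FTC_open_unit : mu.-integrable `]0%R, 1%R[ (EFin \o f) ->
  \int[mu]_(x in `]0, 1[) f x = l1 - l0.
Proof.
move=> intf.
have h : (\int[mu]_(x in J n) (f x)%:E)%E @[n --> \oo] -->
    (\int[mu]_(x in `]0%R, 1%R[) (f x)%:E)%E.
  rewrite (_ : (fun _ => _) = (fun n =>
     \int[mu]_(x in `]0%R, 1%R[) ((EFin \o f) \_ (J n)) x)%E); last first.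
    apply/funext => n; rewrite -integral_mkcondr; congr integral.
    by rewrite setIidr.
  apply: (@dominated_cvg _ _ _ mu `]0%R, 1%R[%classic _
    (fun n => (EFin \o f) \_ (J n)) (EFin \o f) (abse \o (EFin \o f))) => //.
  - move=> n; apply/measurable_restrict => //; first exact: measurable_itv.
    apply/measurable_EFinP; apply: measurable_funS (@subIsetl _ _ _) _ => //.
    exact: measurable_fun_open_unit.
  - move=> x x01; apply: cvg_near_cst.
    have : (\bigcup_n J n) x by rewrite bigcup_J.
    move=> [N _ JN]; exists N => // n /= Nn; rewrite patchE mem_set//.
    by have /subsetPset := J_nd Nn; apply.
  - exact: integrable_abse.
  - by move=> n x x01 /=; rewrite patchE; case: ifPn; rewrite ?abse0// lee_fin.
apply/esym/(@EFin_inj R); rewrite /Rintegral fineK; last exact: integrable_fin_num.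
apply: (cvg_unique _ _ h) => //.
rewrite (_ : (fun _ => _) = EFin \o (fun n => F (1 - a n) - F (a n))).
  by apply: cvg_EFin; [exact: nearW|exact: cvg_F].
by apply/funext => n /=; rewrite integral_J.
Qed.

End FTC_open_unit.

End lebesgue_tools.

(** * Gamma and Beta integrals *)

Section gamma_beta.
Context (R : realType).
Notation mu := (@lebesgue_measure R).
Implicit Types (a b t u x : R).

(** The integrands of Euler's two integrals are extended by zero, so that the
    integrals run over the whole line and Tonelli applies without domains. *)
Definition gammaf a : R -> R :=
  (fun t => t `^ (a - 1) * expR (- t)) \_ `]0, +oo[.

Definition betaf a b : R -> R :=
  (fun u => u `^ (a - 1) * (1 - u) `^ (b - 1)) \_ `]0, 1[.

Lemma gammafE a t : gammaf a t = if 0 < t then t `^ (a - 1) * expR (- t) else 0.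
Proof.
rewrite /gammaf patchE.
by have -> : (t \in `]0, +oo[%classic) = (0 < t) by rewrite mem_setE in_itv /= andbT.
Qed.

Lemma betafE a b u :
  betaf a b u = if 0 < u < 1 then u `^ (a - 1) * (1 - u) `^ (b - 1) else 0.
Proof.
rewrite /betaf patchE.
by have -> : (u \in `]0, 1[%classic) = (0 < u < 1) by rewrite mem_setE in_itv.
Qed.

Lemma gammaf_ge0 a t : 0 <= gammaf a t.
Proof. by rewrite gammafE; case: ifP => // _; rewrite mulr_ge0 ?powR_ge0 ?expR_ge0. Qed.

Lemma betaf_ge0 a b u : 0 <= betaf a b u.
Proof. by rewrite betafE; case: ifP => // _; rewrite mulr_ge0 ?powR_ge0. Qed.

Lemma measurable_gammaf a : measurable_fun setT (gammaf a).
Proof.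
apply/measurable_restrict => //; rewrite setTI; apply: measurable_funTS.
apply: measurable_funM; first exact: measurable_powR.
by apply: measurableT_comp => //; exact: measurable_oppr.
Qed.

Lemma measurable_betaf a b : measurable_fun setT (betaf a b).
Proof.
apply/measurable_restrict => //; rewrite setTI; apply: measurable_funTS.
apply: measurable_funM; first exact: measurable_powR.
apply: (measurableT_comp (measurable_powR _)).
by apply: measurable_funB => //; exact: measurable_cst.
Qed.

(** In the convolution of two Gamma integrands, [s = r u] separates the
    variables [r] and [u]. *)
Lemma gammaf_mul a b r u :
  0 < r :> R -> r * (gammaf a (r * u) * gammaf b (r - r * u)) =
  gammaf (a + b) r * betaf a b u.
Proof.
move=> r0; rewrite !gammafE betafE r0 pmulr_rgt0// subr_gt0.
have -> : (r * u < r) = (u < 1) by rewrite gtr_pMr.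
case: ltP => u0 /=; last by rewrite mul0r !mulr0.
case: ltP => u1; last by rewrite !mulr0.
rewrite (_ : r - r * u = r * (1 - u)); last by ring.
rewrite !powRM ?subr_ge0 ?ltW//.
have -> : expR (- (r * (1 - u))) = expR (- r) / expR (- (r * u)).
  by rewrite -expRN -expRD; congr expR; ring.
have -> : r `^ (a + b - 1) = r `^ (a - 1) * r `^ (b - 1) * r.
  rewrite -[X in _ * X](powRr1 (ltW r0)) -!powRD ?(gt_eqF r0) ?implybT//.
  by congr (_ `^ _); ring.
have e0 : expR (- (r * u)) != 0 by rewrite gt_eqF ?expR_gt0.
by field.
Qed.

(** Translate the second integral by [s], exchange the two integrals, and
    substitute [s = r u] in the inner one. *)
Lemma integral_gammafM a b :
  ((\int[mu]_t (gammaf a t)%:E) * (\int[mu]_t (gammaf b t)%:E) =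
   (\int[mu]_t (gammaf (a + b) t)%:E) * (\int[mu]_u (betaf a b u)%:E))%E.
Proof.
have mg c : measurable_fun setT (EFin \o gammaf c).
  by apply/measurable_EFinP; exact: measurable_gammaf.
have mb : measurable_fun setT (EFin \o betaf a b).
  by apply/measurable_EFinP; exact: measurable_betaf.
have g0 c x : (0 <= (gammaf c x)%:E)%E by rewrite lee_fin gammaf_ge0.
have b0 x : (0 <= (betaf a b x)%:E)%E by rewrite lee_fin betaf_ge0.
rewrite -ge0_integralZr ?integral_ge0//; last exact: mg.
pose h (p : measurableTypeR R * measurableTypeR R) : \bar R :=
  (gammaf a p.1 * gammaf b (p.2 - p.1))%:E.
have mh : measurable_fun setT h.
  apply/measurable_EFinP; apply: measurable_funM.
    by apply: (measurableT_comp (measurable_gammaf a)); exact: measurable_fst.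
  apply: (measurableT_comp (measurable_gammaf b)).
  by apply: measurable_funB; [exact: measurable_snd|exact: measurable_fst].
transitivity (\int[mu]_s \int[mu]_r h (s, r))%E.
  apply: eq_integral => s _.
  rewrite (@ge0_integral_affine R (fun t => (gammaf b t)%:E) 1 (- s))//; last exact: mg.
  rewrite mul1e.
  rewrite -ge0_integralZl//.
  - by apply: eq_integral => r _; rewrite mul1r.
  - apply/measurable_EFinP; apply: (measurableT_comp (measurable_gammaf b)).
    by apply: measurable_funD; [exact: measurable_funM|exact: measurable_cst].
rewrite fubini_tonelli//; last first.
  by move=> p; rewrite lee_fin mulr_ge0 ?gammaf_ge0.
rewrite -ge0_integralZr ?integral_ge0//; last exact: mg.
apply: eq_integral => r _.
have mhr : measurable_fun setT (fun s => h (s, r)).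
  by apply: (measurableT_comp mh); exact: measurable_pair2.
have [r0|r0] := ltP 0 r; last first.
  rewrite [in RHS]gammafE ltNge r0 /= mul0e integral0_eq// => s _.
  rewrite /h /= !gammafE subr_gt0; case: ltP => s0; last by rewrite mul0r.
  by rewrite ltNge (le_trans r0 (ltW s0)) /= mulr0.
rewrite (@ge0_integral_affine R (fun s => h (s, r)) r 0)//; last first.
  by move=> s; rewrite lee_fin mulr_ge0 ?gammaf_ge0.
rewrite -ge0_integralZl//; last first.
- by rewrite lee_fin ltW.
- by move=> s _; rewrite lee_fin mulr_ge0 ?gammaf_ge0.
- apply: (measurableT_comp mhr).
  by apply: measurable_funD; [exact: measurable_funM|exact: measurable_cst].
rewrite -ge0_integralZl; [|exact: measurableT|exact: mb| |exact: g0]; last first.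
  by move=> u _; exact: b0.
by apply: eq_integral => u _; rewrite addr0 -!EFinM gammaf_mul.
Qed.

Lemma continuous_powR_gt0 a x : 0 < x -> {for x, continuous (fun t => t `^ a)}.
Proof.
move=> x0; apply: differentiable_continuous; apply/derivable1_diffP.
by have [] := is_derive1_powR a x0.
Qed.

Lemma integral_powR_unit a : 0 < a ->
  (\int[mu]_(t in `]0%R, 1%R[) (t `^ (a - 1))%:E = (a^-1)%:E)%E.
Proof.
move=> a0; rewrite -[a^-1]subr0.
apply: (@ge0_FTC_open_unit R _ (fun t => a^-1 * t `^ a)).
- move=> x /andP[x0 _]; have := is_derive1_powR a x0 => d.
  have -> : x `^ (a - 1) = a^-1 *: (a * x `^ (a - 1)).
    by rewrite /GRing.scale /= mulrA mulVf ?gt_eqF// mul1r.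
  exact: (is_deriveZ a^-1 d).
- by move=> x /andP[x0 _]; exact: continuous_powR_gt0.
- rewrite -[X in _ --> X](mulr0 a^-1); apply: cvgM; first exact: cvg_cst.
  exact: powR_cvg0.
- have e1 : 1 `^ a = 1 :> R by rewrite powR1.
  rewrite [X in _ --> X](_ : _ = a^-1 * 1 `^ a); last by rewrite e1 mulr1.
  apply: cvgM; first exact: cvg_cst.
  by apply: cvg_at_left_filter; exact: continuous_powR_gt0.
- by move=> x _; exact: powR_ge0.
Qed.

(** The integrand is at most [t^(a - 1)] on ]0, 1[ and at most a multiple of
    [exp (- t / 2)] beyond, because [t / (2 a) <= exp (t / (2 a))] gives [t^a <=
    (2 a)^a exp (t / 2)]. *)
Lemma integral_gammaf_lty a : 0 < a -> (\int[mu]_t (gammaf a t)%:E < +oo)%E.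
Proof.
move=> a0.
pose g1 := (fun t : R => t `^ (a - 1)) \_ `]0, 1[.
pose K := (2 * a) `^ a * 2.
pose g2 := fun t : R => K * exponential_pdf (2^-1) t.
have h0 : 0 < 2^-1 :> R by rewrite invr_gt0.
have K0 : 0 <= K by rewrite mulr_ge0// powR_ge0.
have g10 t : 0 <= g1 t by rewrite /g1 patchE; case: ifP; rewrite ?powR_ge0.
have g20 t : 0 <= g2 t by rewrite /g2 mulr_ge0// exponential_pdf_ge0// ltW.
have mg1 : measurable_fun setT g1.
  apply/measurable_restrict => //; rewrite setTI; apply: measurable_funTS.
  exact: measurable_powR.
have me : measurable_fun setT (exponential_pdf (2^-1 : R)).
  exact: measurable_exponential_pdf.
have mg2 : measurable_fun setT g2 by apply: measurable_funM.
have le t : gammaf a t <= g1 t + g2 t.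
  rewrite gammafE; case: ltP => t0; last by rewrite addr_ge0.
  have [t1|t1] := ltP t 1.
    have -> : g1 t = t `^ (a - 1).
      by rewrite /g1 patchE mem_set//= in_itv /= t0.
    rewrite (@le_trans _ _ (t `^ (a - 1)))// ?lerDl//.
    rewrite -[leRHS]mulr1 ler_wpM2l ?powR_ge0//.
    by rewrite -expR0 ler_expR oppr_le0 ltW.
  rewrite (@le_trans _ _ (g2 t))// ?lerDr//.
  rewrite /g2 /exponential_pdf patchE mem_set/=; last by rewrite in_itv /= andbT ltW.
  rewrite /K (_ : _ * 2 * _ = (2 * a) `^ a * expR (- 2^-1 * t)); last by field.
  have -> : expR (- t) = expR (- 2^-1 * t) * expR (- 2^-1 * t).
    by rewrite -expRD; congr expR; field.
  rewrite mulrA ler_wpM2r ?expR_ge0//.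
  apply: (@le_trans _ _ (t `^ a * expR (- 2^-1 * t))).
    by rewrite ler_wpM2r ?expR_ge0// ler_powR// gerBl.
  have -> : expR (- 2^-1 * t) = (expR (t / (2 * a)) `^ a)^-1.
    rewrite -expRM -expRN; congr expR; field.
    by rewrite gt_eqF.
  rewrite ler_pdivrMr ?powR_gt0 ?expR_gt0//.
  rewrite -powRM ?expR_ge0 ?mulr_ge0 ?(ltW a0)//.
  rewrite ge0_ler_powR ?nnegrE ?(ltW a0) ?(ltW t0) ?mulr_ge0 ?expR_ge0 ?(ltW a0)//.
  rewrite -ler_pdivrMl ?mulr_gt0// mulrC.
  by rewrite (le_trans _ (expR_ge1Dx _))// lerDr.
have : (\int[mu]_t (gammaf a t)%:E <= \int[mu]_t ((g1 t)%:E + (g2 t)%:E))%E.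
  apply: ge0_le_integral => //.
  - by move=> t _; rewrite lee_fin gammaf_ge0.
  - by apply/measurable_EFinP; exact: measurable_gammaf.
  - by apply/measurable_EFinP; exact: measurable_funD.
  - by move=> t _; rewrite -EFinD lee_fin.
move=> /le_lt_trans; apply.
have [mg1' mg2'] : measurable_fun setT (EFin \o g1) /\ measurable_fun setT (EFin \o g2).
  by split; apply/measurable_EFinP.
rewrite ge0_integralD//; last 2 first.
- by move=> t _; rewrite lee_fin.
- by move=> t _; rewrite lee_fin.
have -> : (\int[mu]_t (g1 t)%:E = a^-1%:E)%E.
  rewrite -integral_powR_unit// [RHS]integral_mkcond; apply: eq_integral => t _.
  by rewrite /g1 !patchE; case: ifP.
have -> : (\int[mu]_t (g2 t)%:E = K%:E)%E.
  under eq_integral do rewrite /g2 EFinM.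
  rewrite ge0_integralZl//; last 2 first.
  - by apply/measurable_EFinP.
  - by move=> t _; rewrite lee_fin exponential_pdf_ge0// ltW.
  by rewrite integral_exponential_pdf// mule1.
by rewrite -EFinD ltry.
Qed.

(** On [1, 2] the integrand is at least [exp (- 2) / 2]. *)
Lemma integral_gammaf_gt0 a : 0 < a -> (0 < \int[mu]_t (gammaf a t)%:E)%E.
Proof.
move=> a0.
apply: (@lt_le_trans _ _ (\int[mu]_(t in `[1%R, 2%R]) (2^-1 * expR (- 2))%:E)%E).
  rewrite integral_cst//= lebesgue_measure_itv /= lte_fin ltr1n.
  rewrite -EFinD -EFinM lte_fin mulr_gt0 ?mulr_gt0 ?expR_gt0 ?subr_gt0 ?ltr1n//.
rewrite integral_mkcond; apply: ge0_le_integral => //.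
- by move=> t _; rewrite patchE; case: ifP => // _; rewrite lee_fin mulr_ge0 ?expR_ge0.
- by apply/measurable_restrict => //; apply: measurable_cst.
- by apply/measurable_EFinP; exact: measurable_gammaf.
- move=> t _; rewrite patchE; case: ifPn => [|_]; last by rewrite lee_fin gammaf_ge0.
  rewrite inE /= in_itv /= => /andP[t1 t2]; have t0 : 0 < t by rewrite (lt_le_trans _ t1).
  rewrite lee_fin gammafE t0 ler_pM ?expR_ge0//; last by rewrite ler_expR lerN2.
  apply: (@le_trans _ _ (t `^ (-1))); last by rewrite ler_powR// lerDr ltW.
  by rewrite powR_inv1 ?(ltW t0)// lef_pV2 ?posrE.
Qed.

Lemma EFin_Gamma a : 0 < a -> ((Gamma a)%:E = \int[mu]_t (gammaf a t)%:E)%E.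
Proof.
move=> a0; rewrite /Gamma /Rintegral integral_mkcond.
rewrite (_ : integral _ _ _ = \int[mu]_t (gammaf a t)%:E)%E.
  rewrite fineK// ge0_fin_numE ?integral_gammaf_lty// integral_ge0// => t _.
  by rewrite lee_fin gammaf_ge0.
by apply: eq_integral => t _; rewrite /gammaf !patchE; case: ifP.
Qed.

Lemma Gamma_gt0 a : 0 < a -> 0 < Gamma a.
Proof. by move=> a0; rewrite -lte_fin EFin_Gamma// integral_gammaf_gt0. Qed.

Lemma integral_betaf a b : 0 < a -> 0 < b ->
  (\int[mu]_u (betaf a b u)%:E = (Gamma a * Gamma b / Gamma (a + b))%:E)%E.
Proof.
move=> a0 b0; have ab0 : 0 < a + b by rewrite addr_gt0.
have := integral_gammafM a b; rewrite -!EFin_Gamma// => e.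
have G0 := Gamma_gt0 ab0.
have : (0 <= \int[mu]_u (betaf a b u)%:E)%E.
  by apply: integral_ge0 => u _; rewrite lee_fin betaf_ge0.
move: e; case: (\int[mu]_u _)%E => [r| |] //.
- rewrite -!EFinM => -[->] _; by congr EFin; field; rewrite (gt_eqF G0).
- by rewrite gt0_muley ?lte_fin// -EFinM.
Qed.

End gamma_beta.

(** * The laws kappa *)

Section kappa_probability.
Context (R : realType) (lambda : R).
Hypothesis lambda0 : 0 < lambda.
Notation mu := (@lebesgue_measure R).

Let half0 : 0 < lambda / 2. Proof. by rewrite divr_gt0. Qed.

(** Differs from [kappa_pdf] at 0 and 1 only. The two powers are separated and
    both ends are sent to zero, as in [betaf]. *)
Definition kappa_dens (u : R) : R :=
  Gamma lambda / Gamma (lambda / 2) ^+ 2 * betaf (lambda / 2) (lambda / 2) u.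

Lemma kappa_dens_ge0 u : 0 <= kappa_dens u.
Proof. by rewrite mulr_ge0 ?betaf_ge0 ?divr_ge0 ?exprn_ge0 ?Gamma_ge0. Qed.

Lemma measurable_kappa_dens : measurable_fun setT kappa_dens.
Proof. by apply: measurable_funM => //; exact: measurable_betaf. Qed.

Lemma kappa_pdf_dens u : u != 0 -> u != 1 -> kappa_pdf lambda u = kappa_dens u.
Proof.
move=> u0 u1; rewrite /kappa_pdf /kappa_dens betafE patchE mem_setE in_itv /=.
rewrite !le_eqVlt (negbTE u1) eq_sym (negbTE u0) /=.
case: ifP => [/andP[h0 h1]|]; last by rewrite mulr0.
by rewrite powRM// ?subr_ge0 ltW.
Qed.

Lemma kappaE (A : set R) : measurable A ->
  (kappa lambda A = \int[mu]_(x in A) (kappa_dens x)%:E)%E.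
Proof.
move=> mA; rewrite /kappa; apply: ae_eq_integral => //.
- by apply/measurable_EFinP/measurable_funTS; exact: measurable_kappa_pdf.
- by apply/measurable_EFinP/measurable_funTS; exact: measurable_kappa_dens.
- exists [set 0; 1]; split; first by apply: measurableU.
    by apply: countable_lebesgue_measure0; exact/finite_set_countable/finite_set2.
  move=> x /= h; apply: contrapT => /not_orP[/eqP x0 /eqP x1].
  by apply: h => _; rewrite kappa_pdf_dens.
Qed.

Lemma integral_kappa_dens : (\int[mu]_x (kappa_dens x)%:E = 1)%E.
Proof.
under eq_integral do rewrite EFinM.
rewrite ge0_integralZl//; last 3 first.
- by apply/measurable_EFinP; exact: measurable_betaf.
- by move=> x _; rewrite lee_fin betaf_ge0.
- by rewrite lee_fin divr_ge0 ?exprn_ge0 ?Gamma_ge0.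
rewrite integral_betaf// -splitr -EFinM; congr EFin.
have G1 := gt_eqF (Gamma_gt0 half0); have G2 := gt_eqF (Gamma_gt0 lambda0).
move: (Gamma lambda) (Gamma (lambda / 2)) G1 G2 => g h G1 G2.
by field; rewrite G1 G2.
Qed.

Lemma kappa_setT : kappa lambda setT = 1%E.
Proof. by rewrite kappaE// integral_kappa_dens. Qed.

Definition kappa_prob : probability (measurableTypeR R) R :=
  HB.pack (kappa lambda) (@Measure_isProbability.Build _ _ R (kappa lambda) kappa_setT).

Lemma integrable_kappa_dens : mu.-integrable setT (EFin \o kappa_dens).
Proof.
apply/integrableP; split.
  by apply/measurable_EFinP; exact: measurable_kappa_dens.
under eq_integral do rewrite /= ger0_norm ?kappa_dens_ge0//.
by rewrite integral_kappa_dens ltry.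
Qed.

End kappa_probability.

Section density.
Local Open Scope ereal_scope.

(** The density [g] coincides almost everywhere with the Radon-Nikodym
    derivative. *)
Lemma integral_density d (T : measurableType d) (R : realType)
  (mu : {sigma_finite_measure set T -> \bar R})
  (nu : {finite_measure set T -> \bar R}) (g : T -> R) (f : T -> \bar R) :
  mu.-integrable setT (EFin \o g) ->
  (forall A, measurable A -> nu A = \int[mu]_(x in A) (g x)%:E) ->
  nu.-integrable setT f ->
  \int[nu]_x f x = \int[mu]_x (f x * (g x)%:E).
Proof.
move=> ig nuE intf.
have mg : measurable_fun setT (EFin \o g) := measurable_int _ ig.
have dom : nu `<< mu.
  apply/null_content_dominatesP => A mA A0; rewrite nuE//.
  by apply: null_set_integral => //; exact: measurable_funTS.
rewrite -(Radon_Nikodym_change_of_variables dom)//=.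
apply: ae_eq_integral => //.
- by apply: emeasurable_funM => //; exact: measurable_int intf.
- by apply: emeasurable_funM => //; exact: measurable_int intf.
- apply: ae_eqe_mul2l => /=.
  rewrite Radon_NikodymE//=.
  case: cid => /= h [h1 h2 h3].
  apply: integral_ae_eq => //=.
  by move=> E E01 mE; rewrite -h3// -nuE.
Qed.

End density.

Section kappa_integral.
Context (R : realType) (lambda : R).
Hypothesis lambda0 : 0 < lambda.
Notation mu := (@lebesgue_measure R).

Lemma integrable_bounded_kappa (f : R -> R) (M : R) :
  measurable_fun setT f -> (forall x, `|f x| <= M) ->
  (kappa lambda).-integrable setT (EFin \o f).
Proof.
move=> mf fM; apply: (@measurable_bounded_integrable _ _ _ (kappa_prob lambda0)) => //.
- by rewrite /= kappa_setT// ltry.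
- exists M; split; first exact: num_real.
  by move=> x Mx y _ /=; rewrite (le_trans (fM y))// ltW.
Qed.

Lemma Rintegral_kappa (f : R -> R) (M : R) :
  measurable_fun setT f -> (forall x, `|f x| <= M) ->
  \int[kappa lambda]_x f x = \int[mu]_(x in `]0, 1[) (f x * kappa_dens lambda x).
Proof.
move=> mf fM; congr fine.
rewrite (@integral_density _ _ _ mu (kappa_prob lambda0) (kappa_dens lambda))//.
- rewrite [RHS]integral_mkcond; apply: eq_integral => x _ /=.
  rewrite patchE; case: ifPn; rewrite -?EFinM// mem_setE in_itv /= => /negbTE h.
  by rewrite /kappa_dens betafE h !mulr0.
- exact: integrable_kappa_dens.
- by move=> A mA; exact: kappaE.
- exact: integrable_bounded_kappa fM.
Qed.

End kappa_integral.

(** * Complex-valued functions of a real variable *)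

Section cderive.
Context (R : realType).
Implicit Types (f g : R -> R[i]) (x k p : R) (c d e z : R[i]).

(** Working with the two real coordinates keeps the calculus within functions
    from [R] to [R]. *)
Definition is_cderive x f d :=
  is_derive x (1 : R) (fun t => complex.Re (f t)) (complex.Re d) /\
  is_derive x (1 : R) (fun t => complex.Im (f t)) (complex.Im d).

Lemma is_cderive_eq x f d e : is_cderive x f d -> d = e -> is_cderive x f e.
Proof. by move=> h <-. Qed.

Lemma is_cderiveM x f g d e : is_cderive x f d -> is_cderive x g e ->
  is_cderive x (fun t => f t * g t) (d * g x + f x * e).
Proof.
move=> [f1 f2] [g1 g2]; split.
- have -> : (fun t => complex.Re (f t * g t)) =
    (fun t => complex.Re (f t)) * (fun t => complex.Re (g t)) -
    (fun t => complex.Im (f t)) * (fun t => complex.Im (g t)).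
    by apply/funext => t /=; rewrite !fctE; case: (f t) (g t) => ? ? [].
  apply: is_derive_eq.
  rewrite /GRing.scale /=; case: (f x) (g x) d e {f1 f2 g1 g2} => ? ? [? ?] [? ?] [? ?] /=.
  ring.
- have -> : (fun t => complex.Im (f t * g t)) =
    (fun t => complex.Re (f t)) * (fun t => complex.Im (g t)) +
    (fun t => complex.Im (f t)) * (fun t => complex.Re (g t)).
    by apply/funext => t /=; rewrite !fctE; case: (f t) (g t) => ? ? [].
  apply: is_derive_eq.
  rewrite /GRing.scale /=; case: (f x) (g x) d e {f1 f2 g1 g2} => ? ? [? ?] [? ?] [? ?] /=.
  ring.
Qed.

Lemma is_cderive_cst x c : is_cderive x (fun=> c) 0.
Proof. by split; exact: is_derive_cst. Qed.

Lemma is_cderive_real x (f : R -> R) (d : R) :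
  is_derive x (1 : R) f d -> is_cderive x (fun t => (f t)%:C) d%:C.
Proof. by split => //=; exact: is_derive_cst. Qed.

(** With [X] and [S] the real part and the squared modulus of a point [w] such
    that [Im w > 0], one has [w^p = S^(p/2) cis (p acos (X / sqrt S))]. Both [X]
    and [S] are polynomial along a horizontal line. *)
Lemma is_cderive_cpow_line x k p z : 0 < complex.Im z ->
  is_cderive x (fun t => cpow (z + (k * t)%:C) p)
    ((p * k)%:C * cpow (z + (k * x)%:C) (p - 1)).
Proof.
move=> z0.
pose X t := complex.Re z + k * t.
pose Y := complex.Im z.
pose S t := X t ^+ 2 + Y ^+ 2.
have S0 t : 0 < S t by rewrite /S ltr_wpDl ?sqr_ge0// exprn_gt0.
have dX : is_derive x (1 : R) X k.
  apply: is_derive_eq (is_deriveD (is_derive_cst _ _ _)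
    (is_deriveZ k (is_derive_id x (1 : R)))) _.
  by rewrite add0r /GRing.scale /= mulr1.
have dS : is_derive x (1 : R) S (2 * k * X x).
  have -> : S = X * X + cst (Y ^+ 2) by apply/funext => t; rewrite !fctE.
  apply: is_derive_eq (is_deriveD (is_deriveM dX dX) (is_derive_cst _ _ _)) _.
  rewrite /GRing.scale /=; ring.
have wE t : z + (k * t)%:C = X t +i* Y.
  by rewrite /X /Y; case: (z) => u v; apply/eqP; rewrite eq_complex /= addr0 !eqxx.
have mE t : modc (z + (k * t)%:C) = S t `^ 2^-1.
  by rewrite wE modcE /= powR12_sqrt// ltW.
pose q t := S t `^ (- 2^-1).
have q0 t : 0 < q t by rewrite powR_gt0.
have q2 t : q t ^+ 2 = (S t)^-1.
  rewrite -powR_mulrn ?powR_ge0// -powRrM (_ : - 2^-1 * 2%:R = -1); last by field.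
  by rewrite powR_inv1// ltW.
have tE t : carg (z + (k * t)%:C) = acos (X t * q t).
  rewrite /carg -/(modc _) mE wE /= ltW//; congr acos.
  by rewrite /q powRN.
have fE : (fun t => cpow (z + (k * t)%:C) p) =
    (fun t => (S t `^ (p / 2))%:C * cis (p * acos (X t * q t))).
  by apply/funext => t; rewrite cpowE tE mE -powRrM [2^-1 * p]mulrC.
have SX b : is_derive x (1 : R) (fun t => S t `^ b) (b * S x `^ b / S x * (2 * k * X x)).
  have := is_derive1_comp (is_derive1_powR b (S0 x)) dS.
  move/is_derive_eq; apply; congr (_ * _).
  rewrite -mulrA; congr (_ * _); rewrite powRD; last by rewrite (gt_eqF (S0 x)) implybT.
  by rewrite powR_inv1// ltW.
have dq : is_derive x (1 : R) q (- k * X x * q x / S x).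
  by apply: is_derive_eq (SX _) _; rewrite /q; field; rewrite gt_eqF.
have dh : is_derive x (1 : R) (fun t => X t * q t) (k * q x * Y ^+ 2 / S x).
  apply: is_derive_eq (is_deriveM dX dq) _; rewrite /GRing.scale /=.
  have -> : Y ^+ 2 = S x - X x ^+ 2 by rewrite /S; ring.
  by field; rewrite gt_eqF.
have h2 : 1 - (X x * q x) ^+ 2 = (Y * q x) ^+ 2.
  by rewrite !exprMn q2 /S; field; rewrite gt_eqF//; exact: S0.
have Yq : 0 < Y * q x by rewrite mulr_gt0.
have hlt : -1 < X x * q x < 1.
  rewrite -ltr_norml -ltr_sqr ?nnegrE// real_normK ?num_real// expr1n.
  by rewrite -subr_gt0 h2 exprn_gt0.
have dB : is_derive x (1 : R) (fun t => p * acos (X t * q t)) (- (p * k * Y / S x)).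
  have := @is_derive1_comp R acos (fun t => X t * q t) _ _ _ (is_derive1_acos hlt) dh.
  rewrite h2 sqrtr_sqr gtr0_norm// => d.
  apply: is_derive_eq (is_deriveZ p d) _; rewrite /GRing.scale /=.
  by field; rewrite !gt_eqF.
have dcis : is_cderive x (fun t => cis (p * acos (X t * q t)))
   ((- (p * k * Y / S x))%:C * ('i * cis (p * acos (X x * q x)))).
  split.
  - apply: is_derive_eq (@is_derive1_comp R cos (fun t => p * acos (X t * q t)) _ _ _
      (is_derive_cos _) dB) _ => /=; ring.
  - apply: is_derive_eq (@is_derive1_comp R sin (fun t => p * acos (X t * q t)) _ _ _
      (is_derive_sin _) dB) _ => /=; ring.
have w0 : z + (k * x)%:C != 0.
  by rewrite wE eq_complex /= negb_and (gt_eqF z0) orbT.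
rewrite fE; apply: is_cderive_eq (is_cderiveM (is_cderive_real (SX (p / 2))) dcis) _.
apply: (mulIf w0).
have -> : (p * k)%:C * cpow (z + (k * x)%:C) (p - 1) * (z + (k * x)%:C) =
   (p * k)%:C * ((S x `^ (p / 2))%:C * cis (p * acos (X x * q x))).
  rewrite -mulrA -{2}(cpow1 w0) -cpowD// subrK; congr (_ * _).
  by have /(congr1 (fun f => f x)) := fE.
rewrite wE /cis; apply/eqP; rewrite eq_complex /=; have := S0 x; rewrite /S.
move: (X x) (_ `^ _) (cos _) (sin _) => t a b c t0.
by apply/andP; split; apply/eqP; field; rewrite gt_eqF.
Qed.

End cderive.

Section ccont.
Context (R : realType).
Implicit Types (f g : R -> R[i]) (x : R).

Definition is_ccont x f :=
  {for x, continuous (fun t => complex.Re (f t))} /\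
  {for x, continuous (fun t => complex.Im (f t))}.

Lemma cderive_ccont x f d : is_cderive x f d -> is_ccont x f.
Proof.
move=> [[f1 _] [f2 _]]; split; apply: differentiable_continuous;
exact/derivable1_diffP.
Qed.

Lemma ccont_cst x c : is_ccont x (fun=> c).
Proof. by split; exact: cvg_cst. Qed.

Lemma ccont_real x (f : R -> R) : {for x, continuous f} -> is_ccont x (fun t => (f t)%:C).
Proof. by move=> fc; split => //; exact: cvg_cst. Qed.

Lemma ccontM x f g : is_ccont x f -> is_ccont x g -> is_ccont x (fun t => f t * g t).
Proof.
move=> [f1 f2] [g1 g2]; split.
- rewrite /prop_for /continuous_at.
  have E t : complex.Re (f t * g t) = complex.Re (f t) * complex.Re (g t) -
    complex.Im (f t) * complex.Im (g t) by case: (f t) (g t) => ? ? [].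
  by rewrite E (funext E); apply: cvgB; exact: cvgM.
- rewrite /prop_for /continuous_at.
  have E t : complex.Im (f t * g t) = complex.Re (f t) * complex.Im (g t) +
    complex.Im (f t) * complex.Re (g t) by case: (f t) (g t) => ? ? [].
  by rewrite E (funext E); apply: cvgD; exact: cvgM.
Qed.

Lemma ccontD x f g : is_ccont x f -> is_ccont x g -> is_ccont x (fun t => f t + g t).
Proof.
move=> [f1 f2] [g1 g2]; split; rewrite /prop_for /continuous_at.
- have E t : complex.Re (f t + g t) = complex.Re (f t) + complex.Re (g t).
    by case: (f t) (g t) => ? ? [].
  by rewrite E (funext E); exact: cvgD.
- have E t : complex.Im (f t + g t) = complex.Im (f t) + complex.Im (g t).
    by case: (f t) (g t) => ? ? [].
  by rewrite E (funext E); exact: cvgD.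
Qed.

End ccont.

(** * The kernel identity *)

Section powR_edge.
Context (R : realType).
Variables (f : R -> R) (K a : R).
Hypothesis a0 : 0 < a.
Hypothesis fK : forall u : R, 0 < u < 1 -> `|f u| <= K * (u * (1 - u)) `^ a.

Let near0 e : 0 < e -> exists2 d, 0 < d & forall t, 0 < t < d -> K * t `^ a < e.
Proof.
move=> e0.
have : K * t `^ a @[t --> 0^'+] --> (K * 0).
  by apply: cvgM; [exact: cvg_cst|exact: powR_cvg0].
rewrite mulr0 => /cvgr0_norm_lt /(_ _ e0) [d /= d0 hd]; exists d => // t /andP[t0 td].
rewrite (le_lt_trans (ler_norm _))//; apply: hd => //=.
by rewrite sub0r normrN gtr0_norm.
Qed.

Let K0 : 0 <= K.
Proof.
have h : 0 < (2^-1 : R) < 1 by rewrite invr_gt0 ltr0n /= invf_lt1 ?ltr1n.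
have := fK h; move/(le_trans (normr_ge0 _)); rewrite pmulr_lge0// powR_gt0//.
by rewrite mulr_gt0 ?subr_gt0; move: h => /andP[].
Qed.

(** Near 0 the function is squeezed by a multiple of [u^a]. *)
Lemma cvg0_powR_edge : f u @[u --> 0^'+] --> 0.
Proof.
apply/cvgr0Pnorm_lt => e e0; have [d d0 hd] := near0 e0.
exists (Num.min d 1) => /=; first by rewrite lt_min d0 ltr01.
move=> u /=; rewrite sub0r normrN lt_min => /andP[+ +] u0.
rewrite gtr0_norm// => ud u1; rewrite (le_lt_trans (fK _)) ?u0//.
rewrite (le_lt_trans _ (hd u _)) ?u0// ler_wpM2l// ge0_ler_powR ?nnegrE ?(ltW a0) ?(ltW u0)//.
  by rewrite mulr_ge0 ?subr_ge0 ?ltW.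
by rewrite ler_piMr ?gerBl ?ltW.
Qed.

(** Near 1 the function is squeezed by a multiple of [(1 - u)^a]. *)
Lemma cvg1_powR_edge : f u @[u --> 1^'-] --> 0.
Proof.
apply/cvgr0Pnorm_lt => e e0; have [d d0 hd] := near0 e0.
exists (Num.min d 1) => /=; first by rewrite lt_min d0 ltr01.
move=> u /=; rewrite lt_min => /andP[+ +] u1.
have u1' : 0 < 1 - u by rewrite subr_gt0.
rewrite gtr0_norm// => ud; rewrite ltrBlDr ltrDl => u0.
rewrite (le_lt_trans (fK _)) ?u0//.
rewrite (le_lt_trans _ (hd (1 - u) _)) ?u1'// ler_wpM2l//.
rewrite ge0_ler_powR ?nnegrE ?(ltW a0) ?(ltW u1')//.
  by rewrite mulr_ge0 ?ltW.
by rewrite ler_piMl ?ltW.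
Qed.

End powR_edge.

Section beta_kernel.
Context (R : realType).
Notation mu := (@lebesgue_measure R).
Variables (lambda : R) (z : R[i]).
Hypotheses (lambda0 : 0 < lambda) (z0 : 0 < complex.Im z).

Let a := lambda / 2.
Let a0 : 0 < a. Proof. by rewrite divr_gt0. Qed.
Let L (x p : R) : R[i] := cpow (z + x%:C) p.
Let kd := kappa_dens lambda.

Let Im_line x : complex.Im (z + x%:C) = complex.Im z.
Proof. by case: (z) => ? ? /=; rewrite addr0. Qed.

Let line_neq0 x : z + x%:C != 0.
Proof. by apply: contraTneq z0 => e; rewrite -(Im_line x) e ltxx. Qed.

Let dL x k p : is_cderive x (fun t => L (k * t) p) ((p * k)%:C * L (k * x) (p - 1)).
Proof. exact: is_cderive_cpow_line. Qed.

(** The modulus of [z + x] lies between [Im z] and [|z| + M]; the sum of the two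
    powers bounds [|z + x|^p] for either sign of [p]. *)
Definition cpow_bound (M p : R) := complex.Im z `^ p + (modc z + M) `^ p.

Lemma modc_cpow_line_le (x p M : R) : `|x| <= M -> modc (cpow (z + x%:C) p) <= cpow_bound M p.
Proof.
move=> xM; rewrite modc_cpow.
have ly : complex.Im z <= modc (z + x%:C).
  by rewrite -(Im_line x) (le_trans (ler_norm _))// ler_Im_modc.
have m0 : 0 < modc (z + x%:C) by rewrite (lt_le_trans z0).
have lM : modc (z + x%:C) <= modc z + M.
  by rewrite (le_trans (modc_le_add _ _))// lerD2l modcC.
rewrite /cpow_bound; have [p0|p0] := leP 0 p.
  apply: (@le_trans _ _ ((modc z + M) `^ p)); last by rewrite lerDr powR_ge0.
  by rewrite ge0_ler_powR// nnegrE ltW// (lt_le_trans m0).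
apply: (@le_trans _ _ (complex.Im z `^ p)); last by rewrite lerDl powR_ge0.
rewrite -(opprK p) (powRN (modc _)) (powRN (complex.Im z)).
by rewrite lef_pV2 ?posrE ?powR_gt0// ge0_ler_powR ?nnegrE ?oppr_ge0// ltW.
Qed.

(* [h v u] is the integrand [(z - u v)^(- lambda)] multiplied by [(z - v)^a], and
   [dh] is its derivative in [v]. *)
Let h (v u : R) : R[i] := L (- v) a * L (- (u * v)) (- lambda).

Let dh (v u : R) : R[i] :=
  (- a)%:C * L (- v) (a - 1) * L (- (u * v)) (- lambda) +
  L (- v) a * ((lambda * u)%:C * L (- (u * v)) (- lambda - 1)).

Let is_cderive_h v u : is_cderive v (h ^~ u) (dh v u).
Proof.
have d1 := dL v (-1) a; have d2 := dL v (- u) (- lambda).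
have -> : (h ^~ u) = (fun t => L (-1 * t) a * L (- u * t) (- lambda)).
  by apply/funext => t; rewrite /h mulN1r mulNr.
apply: is_cderive_eq (is_cderiveM d1 d2) _.
by rewrite /dh mulN1r mulNr mulrN1 mulrNN.
Qed.

Let kdE (u : R) : 0 < u < 1 -> kd u =
  Gamma lambda / Gamma a ^+ 2 * (u * (1 - u)) `^ (a - 1).
Proof.
move=> u01; rewrite /kd /kappa_dens -/a betafE u01; move: u01 => /andP[u0 u1].
by rewrite powRM ?subr_ge0 ?ltW.
Qed.

(* [P v] is a primitive in [u] of [dh v] times the density, and it vanishes at 0
   and 1. *)
Let P (v u : R) : R[i] := (- (Gamma lambda / Gamma a ^+ 2))%:C * L (- v) (a - 1) *
  (((u * (1 - u)) `^ a)%:C * L (- v * u) (- lambda)).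

Let is_cderive_P (v u : R) : 0 < u < 1 -> is_cderive u (P v) (dh v u * (kd u)%:C).
Proof.
move=> u01; have /andP[u0 u1] := u01.
have uu0 : 0 < u * (1 - u) by rewrite mulr_gt0// subr_gt0.
have d1 : is_derive u (1 : R) (fun t => t * (1 - t)) (1 - 2 * u).
  apply: is_derive_eq; rewrite /GRing.scale /=; ring.
have d2 := @is_derive1_comp R _ (fun t => t * (1 - t)) _ _ _ (is_derive1_powR a uu0) d1.
have d3 := is_cderiveM (is_cderive_real d2) (dL u (- v) (- lambda)).
have d4 := is_cderiveM (is_cderive_cst u
  ((- (Gamma lambda / Gamma a ^+ 2))%:C * L (- v) (a - 1))) d3.
apply: is_cderive_eq d4 _; rewrite mul0r add0r kdE// /dh /=.
set c := Gamma lambda / _; set b := _ `^ (a - 1); set r := L (- v) (a - 1).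
have -> : (u * (1 - u)) `^ a = b * (u * (1 - u)).
  by rewrite /b -{3}(powRr1 (ltW uu0)) -powRD ?subrK// (gt_eqF uu0) implybT.
rewrite (mulNr v) (mulrC v).
have -> : L (- (u * v)) (- lambda) = L (- (u * v)) (- lambda - 1) * (z + (- (u * v))%:C).
  by rewrite /L -{3}(cpow1 (line_neq0 (- (u * v)))) -cpowD ?line_neq0// subrK.
have -> : L (- v) a = r * (z + (- v)%:C).
  by rewrite /r /L -{3}(cpow1 (line_neq0 (- v))) -cpowD ?line_neq0// subrK.
have -> : lambda = 2 * a by rewrite /a mulrC divfK.
move: (L (- (u * v)) _) => q; move: r => r; move: c b a => c b t.
rewrite !(rmorphM, rmorphD, rmorphN, rmorphB) /=.
by ring.
Qed.

Let line_ccont x k p : is_ccont x (fun t => L (k * t) p).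
Proof. exact: cderive_ccont (dL x k p). Qed.

Let h_ccont v u : is_ccont u (h v).
Proof.
have -> : h v = (fun t => L (- v) a * L (- v * t) (- lambda)).
  by apply/funext => t; rewrite /h mulNr (mulrC v).
by apply: ccontM; [exact: ccont_cst|exact: line_ccont].
Qed.

Let dh_ccont v u : is_ccont u (dh v).
Proof.
have -> : dh v = (fun t => (- a)%:C * L (- v) (a - 1) * L (- v * t) (- lambda) +
   L (- v) a * ((lambda * t)%:C * L (- v * t) (- lambda - 1))).
  by apply/funext => t; rewrite /dh mulNr (mulrC v).
apply: ccontD.
  by apply: ccontM (ccont_cst _ _) (line_ccont _ _ _).
apply: ccontM (ccont_cst _ _) _; apply: ccontM; last exact: line_ccont.
by apply: ccont_real; apply: cvgM; [exact: cvg_cst|exact: cvg_id].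
Qed.

Let integrable_kd : mu.-integrable `]0%R, 1%R[ (EFin \o kd).
Proof. by apply: integrableS (integrable_kappa_dens lambda0). Qed.

Let integrable_bounded_kd (g : R -> R) (C : R) :
  (forall u : R, 0 < u < 1 -> {for u, continuous g}) ->
  (forall u : R, 0 < u < 1 -> `|g u| <= C) ->
  mu.-integrable `]0%R, 1%R[ (fun u => (g u * kd u)%:E).
Proof.
move=> gc gC; have mg : measurable_fun (`]0, 1[%classic : set R) g.
  apply: open_continuous_measurable_fun; first exact: itv_open.
  by move=> x; rewrite inE /= in_itv /= => x01; apply: gc.
apply: (@le_integrable _ _ _ mu _ _ _ (fun u => C%:E * (EFin \o kd) u)%E) => //.
- apply/measurable_EFinP; apply: measurable_funM => //.
  by apply: measurable_funTS; exact: measurable_kappa_dens.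
- move=> u; rewrite /= in_itv /= => u01; rewrite lee_fin !normrM.
  by rewrite ler_wpM2r// (le_trans (gC u u01))// ler_norm.
- exact: integrableZl.
Qed.

Let h_bound (N v u : R) : `|v| <= N -> 0 < u < 1 ->
  modc (h v u) <= cpow_bound N a * cpow_bound N (- lambda).
Proof.
move=> vN /andP[u0 u1]; rewrite modcM ler_pM ?modc_ge0 ?modc_cpow_line_le ?normrN//.
by rewrite normrM (gtr0_norm u0) (le_trans _ vN)// ler_piMl// ltW.
Qed.

Let dh_bound (N v u : R) : `|v| <= N -> 0 < u < 1 ->
  modc (dh v u) <= a * cpow_bound N (a - 1) * cpow_bound N (- lambda) +
    cpow_bound N a * (lambda * cpow_bound N (- lambda - 1)).
Proof.
move=> vN /andP[u0 u1].
have uv : `|- (u * v)| <= N.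
  by rewrite normrN normrM (gtr0_norm u0) (le_trans _ vN)// ler_piMl// ltW.
have vN' : `|- v| <= N by rewrite normrN.
rewrite (le_trans (modc_le_add _ _))// lerD//.
  rewrite 2!modcM modcC normrN (gtr0_norm a0).
  by rewrite !ler_pM ?mulr_ge0 ?modc_ge0 ?modc_cpow_line_le// ltW.
rewrite modcM (modcM (lambda * u)%:C) modcC !ler_pM ?mulr_ge0 ?modc_ge0 ?modc_cpow_line_le//.
by rewrite gtr0_norm ?mulr_gt0// ler_piMr ?ltW.
Qed.

(* The factor [e] makes a real part of either coordinate: [e = 1] gives the real
   part and [e = - 'i] the imaginary part. *)
Let F e v := \int[mu]_(u in `]0, 1[) (complex.Re (e * h v u) * kd u).

Let Re_bound (e w : R[i]) (C : R) : modc w <= C -> `|complex.Re (e * w)| <= modc e * C.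
Proof.
by move=> wC; rewrite (le_trans (ler_Re_modc _))// modcM ler_wpM2l// modc_ge0.
Qed.

Let kd_ge0 u : 0 <= kd u. Proof. exact: kappa_dens_ge0. Qed.

Let P_bound e (v u : R) : 0 < u < 1 -> `|complex.Re (e * P v u)| <=
  (modc e * (modc ((- (Gamma lambda / Gamma a ^+ 2))%:C * L (- v) (a - 1)) *
    cpow_bound `|v| (- lambda))) * (u * (1 - u)) `^ a.
Proof.
move=> /andP[u0 u1]; rewrite -mulrA; apply: Re_bound.
rewrite /P modcM -[leRHS]mulrA ler_wpM2l ?modc_ge0// modcM modcC ger0_norm ?powR_ge0// mulrC.
rewrite ler_wpM2r ?powR_ge0// modc_cpow_line_le//.
by rewrite normrM normrN ler_piMr// gtr0_norm ?ltW.
Qed.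

Let integral_dh e v : \int[mu]_(u in `]0, 1[) (complex.Re (e * dh v u) * kd u) = 0.
Proof.
rewrite -[RHS](subrr 0).
apply: (@FTC_open_unit R _ (fun u => complex.Re (e * P v u))).
- move=> u u01; have [+ _] := is_cderiveM (is_cderive_cst u e) (is_cderive_P v u01).
  move/is_derive_eq; apply; rewrite mul0r add0r mulrA.
  by case: (e * dh v u) => x y /=; rewrite mulr0 subr0.
- move=> u u01; apply: cvgM.
    by have [] := ccontM (ccont_cst u e) (dh_ccont v u).
  have : {near u, (fun u => Gamma lambda / Gamma a ^+ 2 * (u * (1 - u)) `^ (a - 1)) =1 kd}.
    have /near_in_itvoo : u \in `]0, 1[%R by rewrite in_itv.
    by apply: filterS => t; rewrite in_itv /= => /kdE.
  move=> /near_eq_cvg /cvg_trans; rewrite kdE//; apply.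
  apply: cvgM; first exact: cvg_cst.
  have uu0 : 0 < u * (1 - u) by move: u01 => /andP[? ?]; rewrite mulr_gt0// subr_gt0.
  apply: (@continuous_comp _ _ _ (fun t : R => t * (1 - t)) (fun t => t `^ (a - 1))).
    by apply: cvgM; [exact: cvg_id|apply: cvgB; [exact: cvg_cst|exact: cvg_id]].
  exact: continuous_powR_gt0.
- by apply: cvg0_powR_edge a0 _ => u u01; exact: P_bound.
- by apply: cvg1_powR_edge a0 _ => u u01; exact: P_bound.
- apply: (@integrable_bounded_kd (fun u => complex.Re (e * dh v u))).
    by move=> u u01; have [] := ccontM (ccont_cst u e) (dh_ccont v u).
  move=> u u01; apply: Re_bound; exact: (@dh_bound `|v|).
Qed.

Let is_derive_F e v : is_derive v (1 : R) (F e) 0.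
Proof.
pose N := `|v| + 1.
have vI : `]v - 1, v + 1[%classic v by rewrite /= in_itv /= ltrDl ltrBlDr ltrDl ltr01.
have IN x : `]v - 1, v + 1[%classic x -> `|x| <= N.
  rewrite /= in_itv /= => /andP[x1 x2]; rewrite ler_norml /N; apply/andP; split.
    by rewrite (le_trans _ (ltW x1))// opprD lerD2r lerNnormlW.
  by rewrite (le_trans (ltW x2))// lerD2r ler_norm.
pose C := a * cpow_bound N (a - 1) * cpow_bound N (- lambda) +
    cpow_bound N a * (lambda * cpow_bound N (- lambda - 1)).
have C0 : 0 <= C.
  by rewrite /C /cpow_bound !(addr_ge0, mulr_ge0) ?powR_ge0 ?ltW.
pose f v u := complex.Re (e * h v u) * kd u.
have df x u : is_derive x (1 : R) (f ^~ u) (complex.Re (e * dh x u) * kd u).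
  have [+ _] := is_cderiveM (is_cderive_cst x e) (is_cderive_h x u).
  rewrite mul0r add0r => d1.
  have := is_deriveM d1 (is_derive_cst (kd u) x (1 : R)).
  by move/is_derive_eq; apply; rewrite scaler0 add0r /GRing.scale /= mulrC.
have dfE x u : partial1of2 f x u = complex.Re (e * dh x u) * kd u.
  by rewrite partial1of2E; apply: derive_val.
have intf x : `]v - 1, v + 1[%classic x -> mu.-integrable `]0%R, 1%R[ (EFin \o f x).
  move=> Ix; apply: (@integrable_bounded_kd (fun u => complex.Re (e * h x u))).
    by move=> u u01; have [] := ccontM (ccont_cst u e) (h_ccont x u).
  by move=> u u01; apply: Re_bound; exact: (h_bound (IN _ Ix)).
have derf x u : `]v - 1, v + 1[%classic x -> (`]0, 1[%classic : set R) u ->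
  derivable (f ^~ u) x 1 by move=> _ _; have [] := df x u.
pose G u := modc e * C * kd u.
have G0 u : 0 <= G u := mulr_ge0 (mulr_ge0 (modc_ge0 e) C0) (kd_ge0 u).
have intG : mu.-integrable `]0%R, 1%R[ (EFin \o G).
  apply: (@integrable_bounded_kd (fun=> modc e * C) `|modc e * C|) => // u _.
  exact: cvg_cst.
have Gub x u : `]v - 1, v + 1[%classic x -> (`]0, 1[%classic : set R) u ->
  `|partial1of2 f x u| <= G u.
  move=> Ix; rewrite /= in_itv /= => u01; rewrite dfE normrM (ger0_norm (kd_ge0 _)).
  by rewrite ler_wpM2r ?kd_ge0//; apply: Re_bound; exact: dh_bound (IN _ Ix) u01.
have m01 : measurable (`]0, 1[%classic : set (measurableTypeR R)) by exact: measurable_itv.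
have dd := @derivable_under_integral R _ _ mu f _ m01 _ _ _ vI intf derf _ G0 intG Gub.
have := @differentiation_under_integral R _ _ mu f _ m01 _ _ _ vI intf derf _ G0 intG Gub.
rewrite derive1E => D.
apply: DeriveDef; first exact: dd.
rewrite [LHS]D -[RHS](integral_dh e v); apply: eq_Rintegral => u _.
exact: dfE.
Qed.

(** By [is_derive_F] the integral of [e h v] against the density does not depend
    on [v]. At [v = 0] its integrand is constant. The factor [e] is first
    multiplied by [(z - v)^(- lambda/2)], which undoes the factor put into [h]. *)
Lemma Re_integral_kernel e v :
  \int[mu]_(u in `]0, 1[) (complex.Re (e * cpow (z + (- (u * v))%:C) (- lambda)) * kd u)
  = complex.Re (e * (cpow (z + (- v)%:C) (- (lambda / 2)) * cpow z (- (lambda / 2)))).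
Proof.
have z_neq0 : z != 0 by have := line_neq0 0; rewrite addr0.
have := is_derive_0_is_cst v 0 (is_derive_F (e * L (- v) (- a))).
rewrite /F /h => H.
transitivity (F (e * L (- v) (- a)) v).
  apply: eq_Rintegral => u _; rewrite /h; congr (complex.Re _ * _).
  rewrite -/(L _ _) -mulrA (mulrA (L (- v) (- a))) -cpowD ?line_neq0//.
  by rewrite addNr cpow0 mul1r.
rewrite /F H.
transitivity (\int[mu]_(u in `]0, 1[)
  (complex.Re (e * (cpow (z + (- v)%:C) (- (lambda / 2)) * cpow z (- (lambda / 2)))) * kd u)).
  apply: eq_Rintegral => u _; congr (complex.Re _ * _).
  rewrite /L mulr0 oppr0 addr0 -mulrA -cpowD//; congr (_ * (_ * cpow _ _)).
  by rewrite /a; field.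
rewrite RintegralZl//.
rewrite -[RHS]mulr1; congr (_ * _); apply: EFin_inj.
rewrite /Rintegral fineK; last exact: integrable_fin_num.
rewrite -(integral_kappa_dens lambda0) [in LHS]integral_mkcond; apply: eq_integral => u _.
rewrite patchE; case: ifPn => //; rewrite mem_setE in_itv /= => /negbTE h01.
by rewrite /kd /kappa_dens betafE h01 mulr0.
Qed.

End beta_kernel.

(** * Integrals of the Stieltjes kernel *)

Section bounded_integrals.
Context (R : realType) (nu : probability (measurableTypeR R) R).

Lemma integrable_bounded_prob (f : R -> R) (M : R) :
  measurable_fun setT f -> (forall x, `|f x| <= M) ->
  nu.-integrable setT (EFin \o f).
Proof.
move=> mf fM; apply: measurable_bounded_integrable => //.
- by rewrite [X in (X < _)%E](probability_setT nu) ltry.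
- exists M; split; first exact: num_real.
  by move=> x Mx y _ /=; rewrite (le_trans (fM y))// ltW.
Qed.

(** A nonnegative function with zero integral vanishes almost everywhere, and a
    positive function vanishes nowhere. *)
Lemma Rintegral_prob_gt0 (f : R -> R) (M : R) :
  measurable_fun setT f -> (forall x, 0 < f x <= M) -> 0 < \int[nu]_x f x.
Proof.
move=> mf fM.
have fM' x : `|f x| <= M by have /andP[f0 fx] := fM x; rewrite gtr0_norm.
have intf := integrable_bounded_prob mf fM'.
rewrite lt_neqAle Rintegral_ge0 ?andbT; last by move=> x _; have /andP[/ltW] := fM x.
apply/eqP => h.
have h0 : (\int[nu]_x (f x)%:E = 0)%E.
  by rewrite -(fineK (integrable_fin_num _ intf))// -/(Rintegral _ _ _) -h.
have : ae_eq nu setT (EFin \o f) (cst 0%E).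
  apply/ae_eq_integral_abs => //; first exact: measurable_int intf.
  rewrite -h0; apply: eq_integral => x _ /=.
  by have /andP[f0 _] := fM x; rewrite gtr0_norm.
move=> [A [mA A0 sA]].
have : nu setT = 0%E.
  apply/eqP; rewrite eq_le measure_ge0 andbT -A0 le_measure ?inE// => x _.
  apply: sA => /= fx; have [fx0] := fx I.
  by have /andP[] := fM x; rewrite fx0 ltxx.
by rewrite probability_setT => -[] /eqP; rewrite oner_eq0.
Qed.

End bounded_integrals.

Section cintegral_theory.
Context (R : realType) (nu : probability (measurableTypeR R) R).
Implicit Types (f g : R -> R[i]) (c : R[i]).

(** Continuity gives measurability, and boundedness gives integrability under a
    probability. *)
Definition cbounded f := (forall x, is_ccont x f) /\ exists M, forall x, modc (f x) <= M.

Lemma measurable_Re_ccont f : (forall x, is_ccont x f) ->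
  measurable_fun setT (fun x => complex.Re (f x)).
Proof. by move=> fc; apply: continuous_measurable_fun => x; have [] := fc x. Qed.

Lemma measurable_Im_ccont f : (forall x, is_ccont x f) ->
  measurable_fun setT (fun x => complex.Im (f x)).
Proof. by move=> fc; apply: continuous_measurable_fun => x; have [] := fc x. Qed.

Lemma integrable_Re_cbounded f : cbounded f ->
  nu.-integrable setT (EFin \o (fun x => complex.Re (f x))).
Proof.
move=> [fc [M fM]]; apply: (@integrable_bounded_prob _ _ _ M).
  exact: measurable_Re_ccont.
by move=> x; rewrite (le_trans (ler_Re_modc _)).
Qed.

Lemma integrable_Im_cbounded f : cbounded f ->
  nu.-integrable setT (EFin \o (fun x => complex.Im (f x))).
Proof.
move=> [fc [M fM]]; apply: (@integrable_bounded_prob _ _ _ M).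
  exact: measurable_Im_ccont.
by move=> x; rewrite (le_trans (ler_Im_modc _)).
Qed.

Lemma cintegralZ c f : cbounded f ->
  cintegral nu (fun x => c * f x) = c * cintegral nu f.
Proof.
move=> fb; have iR := integrable_Re_cbounded fb; have iI := integrable_Im_cbounded fb.
rewrite /cintegral; case: c => c1 c2; apply/eqP; rewrite eq_complex /=.
have ZR k : nu.-integrable setT (EFin \o (fun x => k * complex.Re (f x))).
  exact: (integrableZl measurableT k iR).
have ZI k : nu.-integrable setT (EFin \o (fun x => k * complex.Im (f x))).
  exact: (integrableZl measurableT k iI).
rewrite -!(RintegralZl _ measurableT iR) -!(RintegralZl _ measurableT iI).
rewrite -(RintegralB measurableT (ZR _) (ZI _)) -(RintegralD measurableT (ZI _) (ZR _)).
by apply/andP; split; apply/eqP; apply: eq_Rintegral => x _; case: (f x).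
Qed.

End cintegral_theory.

Section line_bounds.
Context (R : realType) (z : R[i]).
Hypothesis z0 : 0 < complex.Im z.

Lemma Im_sub_real x : complex.Im (z - x%:C) = complex.Im z.
Proof. by case: (z) => ? ? /=; rewrite subr0. Qed.

Lemma sub_real_neq0 x : z - x%:C != 0.
Proof. by apply: contraTneq z0 => e; rewrite -(Im_sub_real x) e ltxx. Qed.

Lemma modc_sub_real_ge x : complex.Im z <= modc (z - x%:C).
Proof. by rewrite -(Im_sub_real x) (le_trans (ler_norm _))// ler_Im_modc. Qed.

Lemma cbounded_cpow_sub p : 0 <= p -> cbounded (fun x => cpow (z - x%:C) (- p)).
Proof.
move=> p0; split=> [x|].
  have -> : (fun x => cpow (z - x%:C) (- p)) = (fun x => cpow (z + (- 1 * x)%:C) (- p)).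
    by apply/funext => t; rewrite mulN1r rmorphN.
  exact: cderive_ccont (is_cderive_cpow_line _ _ _ z0).
exists ((complex.Im z `^ p)^-1) => x.
have m0 : 0 < modc (z - x%:C) by rewrite (lt_le_trans z0)// modc_sub_real_ge.
rewrite modc_cpow powRN lef_pV2 ?posrE ?powR_gt0//.
by rewrite ge0_ler_powR ?nnegrE ?(ltW z0) ?(ltW m0) ?modc_sub_real_ge.
Qed.

Lemma cpow_sub1 p : (fun x => 1 / cpow (z - x%:C) p) = (fun x => cpow (z - x%:C) (- p)).
Proof. by apply/funext => x; rewrite cpowN ?sub_real_neq0// div1r. Qed.

Lemma stieltjes_kernel : (fun x => 1 / (z - x%:C)) = (fun x => cpow (z - x%:C) (- 1)).
Proof. by apply/funext => x; rewrite cpowN ?sub_real_neq0// cpow1 ?sub_real_neq0// div1r. Qed.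

Lemma cbounded_kernel : cbounded (fun x => 1 / (z - x%:C)).
Proof. by rewrite stieltjes_kernel; exact: cbounded_cpow_sub. Qed.

Lemma Im_kernel x : complex.Im (1 / (z - x%:C)) =
  - (complex.Im z / ((complex.Re z - x) ^+ 2 + complex.Im z ^+ 2)).
Proof. by case: (z) => a b /=; rewrite subr0 !(mul1r, mul0r, addr0). Qed.

Lemma Re_kernel x : complex.Re (1 / (z - x%:C)) =
  (complex.Re z - x) / ((complex.Re z - x) ^+ 2 + complex.Im z ^+ 2).
Proof. by case: (z) => a b /=; rewrite subr0 !(mul1r, mul0r, subr0). Qed.

Lemma Im_stieltjes_lt0 (nu : probability (measurableTypeR R) R) :
  complex.Im (stieltjes nu z) < 0.
Proof.
have [kc [M kM]] := cbounded_kernel.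
rewrite /= -oppr_gt0 -mulN1r -RintegralZl//; last first.
  exact: integrable_Im_cbounded cbounded_kernel.
apply: (@Rintegral_prob_gt0 _ _ _ M).
  by apply: measurable_funM => //; exact: measurable_Im_ccont.
move=> x; rewrite mulN1r; apply/andP; split.
  rewrite Im_kernel opprK divr_gt0// ltr_wpDl ?sqr_ge0//.
  by rewrite exprn_gt0.
by rewrite (le_trans _ (kM x))// (le_trans _ (ler_Im_modc _))// -normrN ler_norm.
Qed.

End line_bounds.

(** * The multiplicative convolution *)

Section product_law.
Context (R : realType).
Variables (lambda : R) (m : probability (measurableTypeR R) R).
Hypothesis lambda0 : 0 < lambda.

Lemma Rintegral_mconv_kappa (g : R -> R) (M : R) :
  measurable_fun setT g -> (forall x, `|g x| <= M) ->
  \int[mconv (kappa lambda) m]_x g x = \int[m]_v \int[kappa lambda]_u g (u * v).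
Proof.
move=> mg gM.
pose phi (p : measurableTypeR R * measurableTypeR R) : measurableTypeR R := p.1 * p.2.
have mphi : measurable_fun setT phi by apply: measurable_funM.
pose K := kappa_prob lambda0.
have mgphi : measurable_fun setT (EFin \o g \o phi).
  by apply: measurableT_comp => //; exact: measurableT_comp.
have KmT : ((K \x m)%E setT = 1)%E.
  rewrite -setXTT product_measure1E//= (probability_setT m).
  by rewrite mule1; exact: (probability_setT K).
have int2 : (K \x m)%E.-integrable setT ((EFin \o g) \o phi).
  apply: (@measurable_bounded_integrable _ _ _ (K \x m)%E (g \o phi)) => //.
  - by rewrite [X in (X < _)%E]KmT ltry.
  - by apply: measurableT_comp.
  - exists M; split; first exact: num_real.
    by move=> x Mx y _ /=; rewrite (le_trans (gM _))// ltW.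
have mg' : measurable_fun setT (EFin \o g) by apply/measurable_EFinP.
pose pm : {measure set (measurableTypeR R) -> \bar R} := pushforward (K \x m)%E phi.
have E1 : (\int[mconv (kappa lambda) m]_x (g x)%:E =
    \int[m]_v \int[K]_u (g (u * v))%:E)%E.
  rewrite (eq_measure_integral (pm mphi)) => [|A mA _]; last by [].
  by rewrite (integral_pushforward mphi mg')// preimage_setT -integral21_prod_meas1.
rewrite /Rintegral E1; congr fine; apply: eq_integral => v _.
rewrite fineK//; apply: integrable_fin_num => //.
apply: (@integrable_bounded_prob _ K _ M) => //.
by apply: (measurableT_comp mg); exact: measurable_funM.
Qed.

Lemma Re_kappa_kernel (z e : R[i]) v : 0 < complex.Im z ->
  \int[kappa lambda]_u complex.Re (e * cpow (z - (u * v)%:C) (- lambda)) =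
  complex.Re (e * (cpow z (- (lambda / 2)) * cpow (z - v%:C) (- (lambda / 2)))).
Proof.
move=> z0; have [gc [M gM]] := cbounded_cpow_sub z0 (ltW lambda0).
rewrite (@Rintegral_kappa _ _ lambda0 _ (modc e * M)); last 2 first.
- have mK : measurable_fun setT (fun x : R => complex.Re (e * cpow (z - x%:C) (- lambda))).
    by apply: measurable_Re_ccont => x; apply: ccontM (ccont_cst _ _) (gc x).
  by apply: (measurableT_comp mK); exact: measurable_funM.
- move=> u; rewrite (le_trans (ler_Re_modc _))// modcM ler_wpM2l ?modc_ge0//.
rewrite [cpow z _ * _]mulrC; have := Re_integral_kernel lambda0 z0 e v.
rewrite rmorphN /= => <-.
by apply: eq_Rintegral => u _; rewrite rmorphN.
Qed.

(** Fubini brings the integral over [kappa lambda] inside, where the kernel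
    identity evaluates it. *)
Lemma cintegral_mconv_kappa (z : R[i]) : 0 < complex.Im z ->
  cintegral (mconv (kappa lambda) m) (fun x => 1 / cpow (z - x%:C) lambda) =
  cpow z (- (lambda / 2)) * cintegral m (fun x => 1 / cpow (z - x%:C) (lambda / 2)).
Proof.
move=> z0; rewrite !cpow_sub1// -cintegralZ; last first.
  by apply: cbounded_cpow_sub => //; rewrite divr_ge0 ?ltW.
have [gc [M gM]] := cbounded_cpow_sub z0 (ltW lambda0).
rewrite /cintegral; congr (_ +i* _).
- rewrite (@Rintegral_mconv_kappa _ M); last 2 first.
  + exact: measurable_Re_ccont.
  + by move=> x; rewrite (le_trans (ler_Re_modc _)).
  apply: eq_Rintegral => v _.
  have := Re_kappa_kernel 1 v z0; rewrite mul1r => <-.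
  by apply: eq_Rintegral => u _; rewrite mul1r.
- rewrite (@Rintegral_mconv_kappa _ M); last 2 first.
  + exact: measurable_Im_ccont.
  + by move=> x; rewrite (le_trans (ler_Im_modc _)).
  have ReNi (w : R[i]) : complex.Re (- 'i * w) = complex.Im w.
    by case: w => a b /=; ring.
  apply: eq_Rintegral => v _.
  rewrite -ReNi -(Re_kappa_kernel (- 'i) v z0).
  by apply: eq_Rintegral => u _; rewrite ReNi.
Qed.

End product_law.

(** * Finitely supported laws and their Boolean powers *)

Section discrete.
Context (R : realType).
Local Notation C := R[i].
Implicit Types (s : seq (R * R)) (z : C).

(** A finitely supported law is a list of pairs (atom, weight), in which an atom
    may occur several times. *)
Definition dprob s := all (fun p => 0 <= p.2) s && (\sum_(p <- s) p.2 == 1).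

Definition dstieltjes s z : C := \sum_(p <- s) p.2%:C / (z - p.1%:C).

Lemma Re_sum (I : Type) (r : seq I) (F : I -> C) :
  complex.Re (\sum_(i <- r) F i) = \sum_(i <- r) complex.Re (F i).
Proof. by elim/big_rec2: _ => //= i x [a b] _ <-; case: (F i). Qed.

Lemma Im_sum (I : Type) (r : seq I) (F : I -> C) :
  complex.Im (\sum_(i <- r) F i) = \sum_(i <- r) complex.Im (F i).
Proof. by elim/big_rec2: _ => //= i x [a b] _ <-; case: (F i). Qed.

(** The spectral law of a Hermitian matrix [A] at a unit vector [e]: its atoms
    are the eigenvalues, weighted by the squared moduli of the coordinates of
    [e] in an orthonormal eigenbasis. The resolvent [(z - A)^(-1) e] enters as
    the solution [y] of a linear system, so that no inverse has to be computed. *)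
Lemma spectral_dstieltjes n (A : 'M[C]_n) (e : 'cV[C]_n) :
  A \is (hermitianmx n false Num.conj) ->
  map_mx Num.conj e^T *m e = 1%:M ->
  exists2 s, dprob s & forall z (y : 'cV[C]_n), 0 < complex.Im z ->
    z *: y - A *m y = e -> map_mx Num.conj e^T *m y = (dstieltjes s z)%:M.
Proof.
move=> hA e1.
pose U := spectralmx A; pose d := spectral_diag A.
have UU : map_mx Num.conj U^T *m U = 1%:M.
  by apply: mulmx1C; apply/unitarymxP; exact: spectral_unitarymx.
have AE : A = invmx U *m diag_mx d *m U.
  exact/orthomx_spectralP/hermitian_normalmx.
have dr k : d 0 k = (complex.Re (d 0 k))%:C.
  rewrite RRe_real//; have /mxOverP := hermitian_spectral_diag_real hA; exact.
pose f := U *m e.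
have dot (v : 'cV[C]_n) : map_mx Num.conj e^T *m v =
   (\sum_k Num.conj (f k 0) * (U *m v) k 0)%:M.
  have -> : map_mx Num.conj e^T *m v = map_mx Num.conj f^T *m (U *m v).
    by rewrite /f trmx_mul map_mxM -!mulmxA [_ *m (U *m v)]mulmxA UU mul1mx.
  apply/matrixP => i j; rewrite !ord1 mxE [RHS]mxE eqxx mulr1n.
  by apply: eq_bigr => k _; rewrite !mxE.
have fE : U *m e = f by [].
clearbody f.
pose s := [seq (complex.Re (d 0 k), modc (f k 0) ^+ 2) | k <- enum 'I_n].
have ff k : Num.conj (f k 0) * f k 0 = (modc (f k 0) ^+ 2)%:C.
  by rewrite mulrC -normCK -modc_norm rmorphXn.
exists s; rewrite /dprob /dstieltjes /s.
- apply/andP; split; first by apply/allP => p /mapP[k _ ->]; exact: sqr_ge0.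
  rewrite big_map /= big_enum /=.
  have := dot e; rewrite e1 fE => /matrixP /(_ 0 0).
  rewrite !mxE eqxx !mulr1n => h.
  rewrite -(inj_eq (@complexI R)) rmorph_sum rmorph1 /= h; apply/eqP.
  by apply: eq_bigr => k _; rewrite ff.
- move=> z y z0 yE; rewrite dot; congr (_%:M).
  rewrite big_map /= big_enum /=; apply: eq_bigr => k _.
  have : U *m (z *: y - A *m y) = f by rewrite yE fE.
  rewrite mulmxBr -scalemxAr AE !mulmxA mulmxV ?spectral_unit// mul1mx -mulmxA.
  move: (U *m y) => g; rewrite mul_diag_mx => /matrixP /(_ k 0); rewrite !mxE => h.
  move: h; rewrite {1}dr -mulrBl => h.
  have D0 := sub_real_neq0 z0 (complex.Re (d 0 k)).
  have -> : g k 0 = f k 0 / (z - (complex.Re (d 0 k))%:C).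
    by rewrite -h [RHS]mulrC mulKf.
  by rewrite mulrA ff.
Qed.

Lemma dprob_ge0 s p : dprob s -> p \in s -> 0 <= p.2.
Proof. by move=> /andP[/allP h _] /h. Qed.

Lemma dprob_sum s : dprob s -> \sum_(p <- s) p.2 = 1.
Proof. by move=> /andP[_ /eqP]. Qed.

Lemma dstieltjes_ord s z : dstieltjes s z =
  \sum_(i < size s) (nth 0 s i).2%:C / (z - (nth 0 s i).1%:C).
Proof. by rewrite /dstieltjes (big_nth 0) big_mkord. Qed.

Lemma Im_dstieltjes_lt0 s z : dprob s -> 0 < complex.Im z ->
  complex.Im (dstieltjes s z) < 0.
Proof.
move=> sP z0; rewrite Im_sum.
pose c := complex.Im z.
have termE (p : R * R) : complex.Im (p.2%:C / (z - p.1%:C)) =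
    - (p.2 * (c / ((complex.Re z - p.1) ^+ 2 + c ^+ 2))).
  rewrite -[_ / _]mulr1 mulrAC -mulrA -[1 * _]/(1 / _ : C).
  have := Im_kernel z p.1; case: (1 / (z - p.1%:C)) => u v /= ->.
  by rewrite mul0r addr0 mulrN.
have k0 (p : R * R) : 0 < c / ((complex.Re z - p.1) ^+ 2 + c ^+ 2).
  by rewrite divr_gt0// ltr_wpDl ?sqr_ge0// exprn_gt0.
under eq_bigr do rewrite termE.
rewrite sumrN oppr_lt0 lt_neqAle; apply/andP; split; last first.
  rewrite big_seq sumr_ge0// => p /(dprob_ge0 sP) p0.
  exact: mulr_ge0 p0 (ltW (k0 p)).
apply/negP => /eqP/esym h.
have : \sum_(p <- s) p.2 = 0.
  rewrite big_seq big1// => p ps.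
  have := h; rewrite (big_rem p)//= => /eqP.
  rewrite paddr_eq0; last 2 first.
  - exact: mulr_ge0 (dprob_ge0 sP ps) (ltW (k0 p)).
  - by rewrite big_seq sumr_ge0// => q /mem_rem/(dprob_ge0 sP) q0;
      exact: mulr_ge0 q0 (ltW (k0 q)).
  by rewrite mulf_eq0 (gt_eqF (k0 p)) orbF => /andP[/eqP].
by rewrite (dprob_sum sP) => /eqP; rewrite oner_eq0.
Qed.

(** The scalar part of [boolean_power], where [r] is the square root of [t]. The
    solution of the linear system is [y = al u + be e], with [u = (z - X)^(-1)
    e]. *)
Lemma boolean_power_field (F : fieldType) (z G r : F) (D := (1 - r ^+ 2) * (z * G) + r ^+ 2)
  (al := r / D) (be := (1 - r) * al * G / r) : r != 0 -> D != 0 ->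
  [/\ be - (1 - r) * (al * G + be) = 0,
     z * be + al * (1 + (1 - r) * (z * G - 1)) = 1 & al * G + be = G / D].
Proof.
move=> r0 D0; rewrite /be /al; split; [by field; rewrite r0|..].
- have E d : d != 0 -> z * ((1 - r) * (r / d) * G / r) +
      r / d * (1 + (1 - r) * (z * G - 1)) = ((1 - r ^+ 2) * (z * G) + r ^+ 2) / d.
    by move=> d0; field; rewrite d0 r0.
  by rewrite E// divff.
- by clear al be; move: D D0 => d d0; field; rewrite d0 r0.
Qed.

(** The new transform [G'] satisfies [z - 1/G' = t (z - 1/G)]: it belongs to the
    Boolean convolution power of exponent [t]. Let [X] be the diagonal matrix of
    the atoms and [e] the unit vector of the square roots of the weights, so
    that [G] is the diagonal coefficient of the resolvent of [X] at [e]. Then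
    [G'] is that of [B X B], where [B = 1 - (1 - sqrt t) e e^T]. *)
Lemma boolean_power s (t : R) : dprob s -> 0 < t <= 1 ->
  exists2 s', dprob s' & forall z, 0 < complex.Im z ->
    dstieltjes s' z = dstieltjes s z / ((1 - t)%:C * (z * dstieltjes s z) + t%:C).
Proof.
move=> sP /andP[t0 t1].
pose n := size s; pose x (i : 'I_n) := (nth 0 s i).1; pose w (i : 'I_n) := (nth 0 s i).2.
have w0 i : 0 <= w i by apply: (dprob_ge0 sP); exact: mem_nth.
have w1 : \sum_i w i = 1 by rewrite -(dprob_sum sP) (big_nth 0) big_mkord.
pose r := Num.sqrt t; pose k := 1 - r.
have r0 : 0 < r by rewrite sqrtr_gt0.
have r2 : r ^+ 2 = t by rewrite sqr_sqrtr// ltW.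
pose q i := (Num.sqrt (w i))%:C : C.
have q2 i : q i * q i = (w i)%:C by rewrite -rmorphM /= -expr2 sqr_sqrtr.
pose e : 'cV[C]_n := \col_i q i.
pose X : 'M[C]_n := diag_mx (\row_i (x i)%:C).
pose B : 'M[C]_n := 1%:M - k%:C *: (e *m e^T).
pose A := B *m X *m B.
have cr (a : R) : Num.conj (a%:C) = a%:C :> C.
  by apply/CrealP; apply/complex_realP; exists a.
have ce : map_mx Num.conj e = e by apply/matrixP => i j; rewrite !mxE; exact: cr.
have ceT : map_mx Num.conj e^T = e^T by apply/matrixP => i j; rewrite !mxE; exact: cr.
have BT : B^T = B by rewrite /B linearB /= trmx1 linearZ /= trmx_mul trmxK.
have cB : map_mx Num.conj B = B.
  rewrite /B map_mxB map_mx1 map_mxZ map_mxM ce ceT; congr (_ - _ *: _).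
  exact: cr.
have cX : map_mx Num.conj X = X.
  by rewrite /X map_diag_mx; congr diag_mx; apply/matrixP => i j;
    rewrite !mxE; exact: cr.
have hA : A \is (hermitianmx n false Num.conj).
  apply/is_hermitianmxP; rewrite expr0 scale1r /A !trmx_mul BT tr_diag_mx !map_mxM.
  by rewrite cB cX mulmxA.
have ee : e^T *m e = 1%:M.
  apply/matrixP => i j; rewrite !ord1 !mxE eqxx mulr1n.
  under eq_bigr do rewrite !mxE q2.
  by rewrite -rmorph_sum w1.
have [|s' s'P s'E] := @spectral_dstieltjes n A e hA; first by rewrite ceT.
exists s' => // z z0.
have zx i : z - (x i)%:C != 0 by exact: sub_real_neq0.
pose u : 'cV[C]_n := \col_i (q i / (z - (x i)%:C)).
have : e^T *m u = (dstieltjes s z)%:M.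
  apply/matrixP => i j; rewrite !ord1 !mxE eqxx mulr1n dstieltjes_ord.
  by apply: eq_bigr => l _; rewrite !mxE mulrA q2.
have Xu : X *m u = z *: u - e.
  rewrite mul_diag_mx; apply/matrixP => i j; rewrite !mxE.
  by move: (q i) (x i)%:C (zx i) => a c d; field.
have := Im_dstieltjes_lt0 sP z0.
move: (dstieltjes s z) => G G0 GE.
have tC : t%:C = r%:C ^+ 2 :> C by rewrite -rmorphXn r2.
have rC0 : r%:C != 0 :> C by rewrite (inj_eq (@complexI R)) gt_eqF.
have Gn0 : G != 0 by apply: contraTneq G0 => ->; rewrite ltxx.
have D0 : (1 - r%:C ^+ 2) * (z * G) + r%:C ^+ 2 != 0.
  have -> : (1 - r%:C ^+ 2) * (z * G) + r%:C ^+ 2 = G * ((1 - t)%:C * z + t%:C / G).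
    rewrite -tC rmorphB rmorph1 /=; clear -Gn0; move: (t%:C) => T.
    by field.
  rewrite mulf_neq0//; apply/eqP => /(congr1 (@complex.Im R)).
  clear -G0 z0 t0 t1; case: G G0 z z0 => a b /= b0 [c d] /= d0 h.
  have n0 : 0 < a ^+ 2 + b ^+ 2 by rewrite ltr_wpDl ?sqr_ge0// -sqrrN exprn_gt0// oppr_gt0.
  have : 0 < (1 - t) * d + t * (- b / (a ^+ 2 + b ^+ 2)).
    rewrite ltr_wpDl ?mulr_ge0 ?subr_ge0 ?(ltW d0)// mulr_gt0// divr_gt0//.
    by rewrite oppr_gt0.
  by rewrite mulNr; move: h; rewrite !mul0r !addr0 => ->; rewrite ltxx.
rewrite rmorphB rmorph1 /= tC.
have kC : k%:C = 1 - r%:C :> C by rewrite /k rmorphB rmorph1.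
have := boolean_power_field rC0 D0.
set D := (1 - _) * _ + _ in D0 *; set al := _ / D; set be := _ / r%:C.
move=> [be0 albe GD]; rewrite -GD; clearbody al be; clear D GD D0.
pose y := al *: u + be *: e.
have eTy : e^T *m y = (al * G + be)%:M.
  by rewrite /y mulmxDr -!scalemxAr GE ee !scale_scalar_mx mulr1 -raddfD.
have kbe : k%:C * (al * G + be) = be.
  by rewrite kC; apply/esym/eqP; rewrite -subr_eq0 be0.
have By : B *m y = al *: u.
  rewrite /B mulmxBl mul1mx -scalemxAl -mulmxA eTy mul_mx_scalar scalerA kbe.
  exact: addrK.
have Ay : A *m y = al *: (z *: u - e - (k%:C * (z * G - 1)) *: e).
  rewrite /A -mulmxA By -mulmxA -!scalemxAr Xu; congr (_ *: _).
  rewrite /B mulmxBl mul1mx; congr (_ - _).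
  rewrite -scalemxAl -mulmxA mulmxBr -scalemxAr GE ee scale_scalar_mx -raddfB.
  by rewrite mul_mx_scalar scalerA.
have yE : z *: y - A *m y = e.
  apply/matrixP => i j; rewrite Ay /y !mxE kC.
  transitivity ((z * be + al * (1 + (1 - r%:C) * (z * G - 1))) * q i).
    by move: (q i) (z - (x i)%:C)^-1 r%:C => a b c; ring.
  by rewrite albe mul1r.
have := s'E z y z0 yE; rewrite ceT eTy => /matrixP /(_ 0 0).
by rewrite !mxE eqxx !mulr1n => <-.
Qed.

End discrete.

(** * Square roots as averages of Boolean powers *)

Section square_root_mean.
Context (R : realType).
Local Notation C := R[i].
Implicit Types (s w z : C) (c : R).

(** The roots of the Chebyshev polynomial of degree [2^m]: from [T_(2 k) (g) =
    T_k (2 g^2 - 1)] and the symmetry of the roots, [g] is a root at one stage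
    if and only if [1 - 2 g^2] is a root at the previous one. *)
Fixpoint cheb m : seq R :=
  if m is m'.+1 then
    flatten [seq [:: Num.sqrt ((1 - c) / 2); - Num.sqrt ((1 - c) / 2)] | c <- cheb m']
  else [:: 0].

(** With [t = (1 + c) / 2] this is [w / ((1 - t) w + t)]. When [w = z G], it is
    [z G'] for the Boolean power [G'] of exponent [t]. *)
Definition hmean c w : C := 2 * w / ((1 + w) + c%:C * (1 - w)).

Definition cheb_mean m w : C := (\sum_(c <- cheb m) hmean c w) / 2 ^+ m.

Lemma cheb_node m c : c \in cheb m -> -1 < c < 1.
Proof.
elim: m c => [|m IH] c /=.
  by rewrite inE => /eqP ->; rewrite ltr01 ltrN10.
move=> /flatten_mapP[d /IH /andP[d1 d2]].
have h : Num.sqrt ((1 - d) / 2) < 1.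
  rewrite -[X in _ < X]sqrtr1 ltr_sqrt// ltr_pdivrMr// mul1r; lra.
have h0 : 0 <= Num.sqrt ((1 - d) / 2) by exact: sqrtr_ge0.
by rewrite !inE => /orP[] /eqP ->; apply/andP; split; lra.
Qed.

Lemma size_cheb m : size (cheb m) = (2 ^ m)%N.
Proof.
elim: m => //= m IH; rewrite size_flatten /shape -map_comp expnS -IH.
by elim: (cheb m) => //= a l ->; rewrite mulnS.
Qed.

Lemma hmean_den_neq0 c s : 0 < complex.Re s -> -1 < c < 1 ->
  (1 + s ^+ 2) + c%:C * (1 - s ^+ 2) != 0.
Proof.
case: s => x y /= x0 /andP[c1 c2]; apply/eqP => /eqP.
rewrite eq_complex /= => /andP[/eqP hr /eqP hi].
have h : (1 - c) * (2 * x * y) = 0.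
  by move: hi; rewrite !mul0r; lra.
have y0 : y = 0.
  apply/eqP; move/eqP: h; rewrite !mulf_eq0 subr_eq0.
  by rewrite (gt_eqF c2) (gt_eqF x0) pnatr_eq0.
move: hr; rewrite y0 !(mul0r, mulr0, subr0, oppr0).
have := mulr_gt0 x0 x0; nra.
Qed.

Lemma one_add_sqr_neq0 s : 0 < complex.Re s -> 1 + s ^+ 2 != 0.
Proof.
move=> s0; have := @hmean_den_neq0 0 s s0; rewrite mul0r addr0; apply.
by rewrite ltr01 ltrN10.
Qed.

Lemma one_add_neq0 s : 0 < complex.Re s -> 1 + s != 0.
Proof.
by case: s => x y /= x0; rewrite eq_complex /= negb_and gt_eqF// addr_gt0.
Qed.

(** Both sides are rational in [g] and invariant under [g -> - g]; the product
    of the two denominators on the left is, up to the factor [(1 + s^2)^2 / 2],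
    the denominator on the right. *)
Lemma hmean_pair c g s : 0 < complex.Re s -> -1 < g < 1 -> -1 < c < 1 ->
  g ^+ 2 = (1 - c) / 2 ->
  hmean g (s ^+ 2) + hmean (- g) (s ^+ 2) =
  (1 + s ^+ 2) * hmean c ((2 * s / (1 + s ^+ 2)) ^+ 2).
Proof.
move=> s0 g1 c1 g2.
have gN : -1 < - g < 1 by case/andP: g1 => *; apply/andP; split; lra.
have := hmean_den_neq0 s0 g1; have := hmean_den_neq0 s0 gN.
have := one_add_sqr_neq0 s0; rewrite /hmean.
have -> : c = 1 - 2 * g ^+ 2 by rewrite g2; field.
rewrite rmorphB rmorph1 rmorphM rmorphXn rmorphN /= rmorph_nat.
clear g1 c1 g2 gN; move: g%:C => h D0 Dm Dp.
have -> : 1 + (2 * s / (1 + s ^+ 2)) ^+ 2 + (1 - 2 * h ^+ 2) *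
    (1 - (2 * s / (1 + s ^+ 2)) ^+ 2) =
  2 * ((1 + s ^+ 2 + h * (1 - s ^+ 2)) * (1 + s ^+ 2 + - h * (1 - s ^+ 2))) /
    (1 + s ^+ 2) ^+ 2 by field.
by field; rewrite D0 Dm Dp.
Qed.

Lemma Re_newton_gt0 s : 0 < complex.Re s -> 0 < complex.Re (2 * s / (1 + s ^+ 2)).
Proof.
move=> s0; have := one_add_sqr_neq0 s0; rewrite -modc_gt0.
move=> h; have := exprn_gt0 2 h; rewrite sqr_modc.
case: s s0 {h} => x y /= x0; rewrite add0r => N0.
rewrite (_ : _ - _ = 2 * x * (1 + x ^+ 2 + y ^+ 2) /
  ((1 + (x * x - y * y)) ^+ 2 + (x * y + y * x) ^+ 2)); last by field; rewrite gt_eqF.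
by rewrite divr_gt0// !mulr_gt0// ltr_wpDr ?sqr_ge0// ltr_wpDr ?sqr_ge0.
Qed.

Lemma cheb_mean_rec m s : 0 < complex.Re s ->
  cheb_mean m.+1 (s ^+ 2) = (1 + s ^+ 2) / 2 * cheb_mean m ((2 * s / (1 + s ^+ 2)) ^+ 2).
Proof.
move=> s0; rewrite /cheb_mean /= big_flatten /= big_map.
rewrite (eq_big_seq (fun c => (1 + s ^+ 2) * hmean c ((2 * s / (1 + s ^+ 2)) ^+ 2))).
  rewrite -mulr_sumr [2 ^+ m.+1]exprS invfM; move: (\sum_(i <- _) _) (2 ^+ m)^-1 => S T.
  exact: mulrACA.
move=> c cm; rewrite big_cons big_seq1.
have gm e : e \in [:: Num.sqrt ((1 - c) / 2); - Num.sqrt ((1 - c) / 2)] -> -1 < e < 1.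
  by move=> em; apply: (@cheb_node m.+1) => /=; apply/flatten_mapP; exists c.
have c1 := cheb_node cm.
apply: hmean_pair => //; first by apply: gm; rewrite mem_head.
by rewrite sqr_sqrtr// divr_ge0// subr_ge0 ltW//; case/andP: c1.
Qed.

(** The Cayley transform conjugates [s -> 2 s / (1 + s^2)] to squaring
    ([cayley_newton]), and it maps the right half-plane into the unit disc. *)
Definition cayley s : C := (1 - s) / (1 + s).

Lemma modc_cayley_lt1 s : 0 < complex.Re s -> modc (cayley s) < 1.
Proof.
move=> s0; rewrite /cayley modcM modcV ltr_pdivrMr ?modc_gt0 ?one_add_neq0// mul1r.
rewrite -ltr_sqr ?nnegrE ?modc_ge0// !sqr_modc.
by case: s s0 => x y /= x0; nra.
Qed.

Lemma one_add_lt1_neq0 w : modc w < 1 -> 1 + w != 0.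
Proof.
move=> w1; apply/eqP => /eqP; rewrite addr_eq0 => /eqP e.
by move: w1; rewrite -modcN -e modcC normr1 ltxx.
Qed.

Lemma cayley_newton s : 0 < complex.Re s ->
  cayley (2 * s / (1 + s ^+ 2)) = cayley s ^+ 2.
Proof.
move=> s0; have D0 := one_add_sqr_neq0 s0; have E0 := one_add_neq0 s0.
rewrite /cayley.
have -> : 1 + 2 * s / (1 + s ^+ 2) = (1 + s) ^+ 2 / (1 + s ^+ 2) by field.
by field; rewrite D0 E0.
Qed.

(** Each step of [cheb_mean_rec] squares the Cayley transform of the argument.
    The averages at [s^2] are thus rational approximations of [s], with an error
    of order [|cayley s|^(2^(m + 1))]. *)
Lemma cheb_mean_sqr m s : 0 < complex.Re s ->
  cheb_mean m (s ^+ 2) =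
  s * (1 - cayley s ^+ (2 ^ m.+1)) / (1 + cayley s ^+ (2 ^ m.+1)).
Proof.
elim: m s => [|m IH] s s0.
  rewrite expn1 /cheb_mean big_seq1 expr0 divr1 /hmean mul0r addr0.
  have D0 := one_add_sqr_neq0 s0; have E0 := one_add_neq0 s0; rewrite /cayley.
  have -> : 1 + ((1 - s) / (1 + s)) ^+ 2 = 2 * (1 + s ^+ 2) / (1 + s) ^+ 2 by field.
  by field; rewrite D0 E0.
rewrite cheb_mean_rec// IH ?Re_newton_gt0// cayley_newton// -exprM -expnS.
have D0 := one_add_sqr_neq0 s0.
have : 1 + cayley s ^+ (2 ^ m.+2) != 0.
  by apply: one_add_lt1_neq0; rewrite modcX exprn_ilt1 ?modc_ge0 ?modc_cayley_lt1// expn_eq0.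
move: (_ ^+ (2 ^ m.+2)) => Q Q0.
by field; rewrite D0 Q0.
Qed.

(** An average of Boolean powers is a mixture of finitely supported laws. *)
Lemma cheb_mean_dstieltjes (s : seq (R * R)) m : dprob s ->
  exists2 s', dprob s' & forall z, 0 < complex.Im z ->
    dstieltjes s' z = cheb_mean m (z * dstieltjes s z) / z.
Proof.
move=> sP.
have key (cs : seq R) : {in cs, forall c, -1 < c < 1} ->
  exists s' : seq (R * R), [/\ all (fun p => 0 <= p.2) s', \sum_(p <- s') p.2 = (size cs)%:R &
    forall z, 0 < complex.Im z ->
    dstieltjes s' z = (\sum_(c <- cs) hmean c (z * dstieltjes s z)) / z].
  elim: cs => [|c cs IH] h.
    exists [::]; split => //; first by rewrite big_nil.
    by move=> z _; rewrite /dstieltjes !big_nil mul0r.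
  have [d dcs|s1 [p1 w1 e1]] := IH; first by apply: h; rewrite inE dcs orbT.
  have /andP[c1 c2] : -1 < c < 1 by apply: h; rewrite mem_head.
  have [|s2 s2P e2] := @boolean_power R s ((1 + c) / 2) sP.
    by apply/andP; split; lra.
  exists (s2 ++ s1); split.
  - by rewrite all_cat p1 andbT; case/andP: s2P.
  - by rewrite big_cat /= w1 (dprob_sum s2P) -natr1 addrC.
  - move=> z z0; rewrite /dstieltjes big_cat /= -!/(dstieltjes _ _) e1// e2//.
    rewrite [in RHS]big_cons [in RHS]mulrDl; congr (_ + _).
    have z1 : z != 0 by apply: contraTneq z0 => ->; rewrite ltxx.
    rewrite /hmean; move: (dstieltjes s z) => G.
    have -> : (1 + z * G + c%:C * (1 - z * G)) =
      2 * ((1 - (1 + c) / 2)%:C * (z * G) + ((1 + c) / 2)%:C).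
      rewrite !(rmorphB, rmorphM, rmorphD, rmorph1, fmorphV, rmorph_nat) /=.
      by field.
    rewrite invfM; move: (_ + _)^-1 => D.
    by field.
have [s' [p' w' e']] := key _ (@cheb_node m).
have t0 : 0 < 2 ^+ m :> R by rewrite exprn_gt0.
exists [seq (p.1, p.2 / 2 ^+ m) | p <- s'].
  apply/andP; split.
    rewrite all_map; apply: sub_all p' => p /= p0.
    by rewrite divr_ge0// ltW.
  rewrite big_map -mulr_suml w' size_cheb natrX divff//.
move=> z z0; rewrite /cheb_mean mulrAC -e'// /dstieltjes big_map mulr_suml.
apply: eq_bigr => p _ /=; rewrite rmorphM fmorphV rmorphXn rmorph_nat /=.
by rewrite mulrAC.
Qed.

(** [w^2 - s^2 = (w - s) (w + s)], and [|w + s|] is at least [Re s]. *)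
Lemma modc_sqrt_dist s w : 0 < complex.Re s -> 0 < complex.Re w ->
  modc (w - s) <= modc (w ^+ 2 - s ^+ 2) / complex.Re s.
Proof.
move=> s0 w0; rewrite subr_sqr modcM ler_pdivlMr// ler_wpM2l ?modc_ge0//.
rewrite (le_trans _ (ler_Re_modc _))//.
by case: s w s0 w0 => x y [a b] /= x0 a0; rewrite ger0_norm ?lerDr ?addr_ge0 ?ltW.
Qed.

Lemma modc_cayley_dist s w : 0 < complex.Re s -> 0 < complex.Re w ->
  modc (cayley w - cayley s) <= 2 * modc (w - s).
Proof.
move=> s0 w0; have S0 := one_add_neq0 s0; have W0 := one_add_neq0 w0.
have -> : cayley w - cayley s = 2 * (s - w) / ((1 + w) * (1 + s)).
  by rewrite /cayley; field; rewrite S0 W0.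
have two : modc (2 : C) = 2 by rewrite -(rmorph_nat (real_complex R)) modcC normr_nat.
have h (u : C) : 0 < complex.Re u -> 1 <= modc (1 + u).
  move=> u0; rewrite (le_trans _ (ler_Re_modc _))//.
  by case: u u0 => a b /= a0; rewrite ger0_norm ?lerDl ?addr_ge0 ?ltW.
rewrite modcM modcV !modcM two -[s - w]opprB modcN.
rewrite ler_pdivrMr ?mulr_gt0 ?modc_gt0// ler_peMr ?mulr_ge0 ?modc_ge0//.
by rewrite mulr_ege1 ?h.
Qed.

(** The argument may vary with the order [n]: once [u n] is close to [s], the
    modulus of [cayley (u n)] stays below a constant [r < 1], and so the error
    at [u n] is at most of order [r^n]. *)
Lemma cheb_mean_cvg (u : nat -> C) s : 0 < complex.Re s ->
  (forall n, 0 < complex.Re (u n)) ->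
  modc (u n ^+ 2 - s ^+ 2) @[n --> \oo] --> (0 : R) ->
  modc (cheb_mean n (u n ^+ 2) - s) @[n --> \oo] --> (0 : R).
Proof.
move=> s0 u0 cu.
have cus : modc (u n - s) @[n --> \oo] --> (0 : R).
  apply: (@squeeze_cvgr _ _ _ _ (cst 0) (fun n => modc (u n ^+ 2 - s ^+ 2) / complex.Re s)).
  - by apply: nearW => n; rewrite /= modc_ge0 modc_sqrt_dist.
  - exact: cvg_cst.
  - rewrite -[X in _ --> X](mul0r (complex.Re s)^-1).
    by apply: cvgM => //; exact: cvg_cst.
pose q := modc (cayley s); pose r := (1 + q) / 2.
have q1 : q < 1 by exact: modc_cayley_lt1.
have q0 : 0 <= q by exact: modc_ge0.
have r1 : r < 1 by rewrite /r; lra.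
have r0 : 0 <= r by rewrite /r; lra.
pose Q n := cayley (u n) ^+ (2 ^ n.+1).
have Qle : \forall n \near \oo, modc (Q n) <= r ^+ n.
  have e0 : 0 < (1 - q) / 4 by lra.
  have /cvgr0_norm_lt /(_ _ e0) := cus; apply: filterS => n.
  rewrite ger0_norm ?modc_ge0// => h.
  have h1 : modc (cayley (u n)) <= r.
    have -> : cayley (u n) = (cayley (u n) - cayley s) + cayley s by rewrite subrK.
    rewrite (le_trans (modc_le_add _ _))//.
    have := modc_cayley_dist s0 (u0 n); rewrite -/q /r; lra.
  rewrite /Q modcX (le_trans (lerXn2r _ _ _ h1)) ?nnegrE ?modc_ge0//.
  rewrite ler_wiXn2l// ?ltW// (leq_trans _ (ltnW (ltn_expl _ _)))//.
have crn : r ^+ n @[n --> \oo] --> (0 : R).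
  by apply: cvg_expr; rewrite ger0_norm.
have cQ : modc (Q n) @[n --> \oo] --> (0 : R).
  apply: (@squeeze_cvgr _ _ _ _ (cst 0) (fun n => r ^+ n)) => //.
  - by apply: filterS Qle => n ->; rewrite modc_ge0.
  - exact: cvg_cst.
apply: (@squeeze_cvgr _ _ _ _ (cst 0)
  (fun n => modc (u n - s) + 4 * modc (Q n) * (modc (u n - s) + modc s))).
- have h0 : 0 < 2^-1 :> R by rewrite invr_gt0.
  have /cvgr0_norm_lt /(_ _ h0) := cQ; apply: filterS => n.
  rewrite (ger0_norm (modc_ge0 _)) => Qh; apply/andP; split; first exact: modc_ge0.
  rewrite cheb_mean_sqr// -/(Q n).
  have Q1 : 1 + Q n != 0 by apply: one_add_lt1_neq0; lra.
  have -> : u n * (1 - Q n) / (1 + Q n) - s = (u n - s) - 2 * Q n / (1 + Q n) * (u n - s + s).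
    by field.
  rewrite (le_trans (modc_le_add _ _))// lerD2l modcN modcM.
  apply: ler_pM; rewrite ?modc_ge0 ?modc_le_add// !modcM modcV.
  have -> : modc (2 : C) = 2 by rewrite -(rmorph_nat (real_complex R)) modcC normr_nat.
  have : 2^-1 <= modc (1 + Q n).
    have := modc_le_add (1 + Q n) (- Q n); rewrite addrK modcN modcC normr1; lra.
  move=> h; rewrite ler_pdivrMr ?modc_gt0//; have := modc_ge0 (Q n); nra.
- exact: cvg_cst.
- rewrite [X in _ --> X](_ : _ = 0 + 4 * 0 * (0 + modc s)); last by rewrite mulr0 mul0r addr0.
  apply: cvgD => //; apply: cvgM.
    by apply: cvgM => //; exact: cvg_cst.
  by apply: cvgD => //; exact: cvg_cst.
Qed.

End square_root_mean.

(** * Approximation by finitely supported laws *)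

Section discretization.
Context (R : realType) (nu : probability (measurableTypeR R) R).
Import HBSimple.

Definition sfun_law (g : {sfun measurableTypeR R >-> R}) : seq (R * R) :=
  [seq (y, fine (nu (g @^-1` [set y]))) | y <- fset_set (range g)].

Lemma integral_sfun_law (g : {sfun measurableTypeR R >-> R}) (h : R -> R) :
  \int[nu]_x h (g x) = \sum_(p <- sfun_law g) p.2 * h p.1.
Proof.
pose l : seq R := fset_set (range g).
have mg y : measurable (g @^-1` [set y]) by exact: measurable_sfunP.
have hE x : (h (g x))%:E =
    (\sum_(y <- l) (h y)%:E * (\1_(g @^-1` [set y]) x)%:E)%E.
  have gl : g x \in l by rewrite /l in_fset_set; [apply/mem_set; exists x|exact: fimfunP].
  rewrite (bigD1_seq (g x))//=; last exact: fset_uniq.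
  rewrite big1 => [|y /negbTE yx]; last first.
    rewrite indicE [_ \in _](_ : _ = false) ?mule0//.
    by apply/negP => /set_mem /= e; move: yx; rewrite -e eqxx.
  by rewrite adde0 indicE mem_set// mule1.
rewrite /Rintegral.
under eq_integral do rewrite hE.
have ii y : nu.-integrable setT (fun x => ((h y)%:E * (\1_(g @^-1` [set y]) x)%:E)%E).
  by apply: integrableZl => //; apply: integrable_indic.
rewrite integral_sum// -/l.
rewrite (eq_bigr (fun y => (h y * fine (nu (g @^-1` [set y])))%:E)); last first.
  move=> y _; rewrite integralZl//; last by apply: integrable_indic.
  rewrite integral_indic// setIT EFinM fineK//; exact: fin_num_measure.
rewrite sumEFin /= /sfun_law big_map; apply: eq_bigr => y _ /=.
by rewrite mulrC.
Qed.

Lemma dprob_sfun_law (g : {sfun measurableTypeR R >-> R}) : dprob (sfun_law g).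
Proof.
apply/andP; split; first by apply/allP => p /mapP[y _ ->]; rewrite fine_ge0.
have := integral_sfun_law g (fun=> 1).
under [X in _ = X -> _]eq_bigr do rewrite mulr1.
move=> <-; rewrite Rintegral_cst// mul1r.
by rewrite [X in fine X](probability_setT nu).
Qed.

Lemma dstieltjesE (s : seq (R * R)) (z : R[i]) : dstieltjes s z =
  (\sum_(p <- s) p.2 * complex.Re (1 / (z - p.1%:C))) +i*
  (\sum_(p <- s) p.2 * complex.Im (1 / (z - p.1%:C))).
Proof.
have E (p : R * R) : p.2%:C / (z - p.1%:C) =
    (p.2 * complex.Re (1 / (z - p.1%:C))) +i* (p.2 * complex.Im (1 / (z - p.1%:C))).
  rewrite -[p.2%:C]mulr1 -mulrA; case: (1 / _) => a b.
  by apply/eqP; rewrite eq_complex /= !mul0r subr0 addr0 !eqxx.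
apply/eqP; rewrite eq_complex /dstieltjes Re_sum Im_sum.
by apply/andP; split; apply/eqP; apply: eq_bigr => p _; rewrite E.
Qed.

Lemma Re_dstieltjes (s : seq (R * R)) (z : R[i]) : complex.Re (dstieltjes s z) =
  \sum_(p <- s) p.2 * complex.Re (1 / (z - p.1%:C)).
Proof. by rewrite dstieltjesE. Qed.

Lemma Im_dstieltjes (s : seq (R * R)) (z : R[i]) : complex.Im (dstieltjes s z) =
  \sum_(p <- s) p.2 * complex.Im (1 / (z - p.1%:C)).
Proof. by rewrite dstieltjesE. Qed.

Lemma cvg_Rintegral_bounded (f : R -> R) (h : (R -> R)^nat) (M : R) :
  (forall n, measurable_fun setT (h n)) -> measurable_fun setT f ->
  (forall n x, `|h n x| <= M) -> (forall x, `|f x| <= M) ->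
  (forall x, h n x @[n --> \oo] --> f x) ->
  \int[nu]_x h n x @[n --> \oo] --> \int[nu]_x f x.
Proof.
move=> mh mf hM fM hf.
apply: fine_cvg; rewrite fineK; last first.
  by apply: integrable_fin_num => //; exact: integrable_bounded_prob mf fM.
apply: (@dominated_cvg _ _ _ nu setT _ (fun n x => (h n x)%:E) (EFin \o f) (cst M%:E)) => //.
- by move=> n; apply/measurable_EFinP; exact: mh.
- by move=> x _; apply: cvg_EFin (hf x); exact: nearW.
- exact: finite_measure_integrable_cst.
- by move=> n x _ /=; rewrite lee_fin.
Qed.

Lemma cvg_Rintegral_sfun (f : R -> R) (M : R)
    (g : {sfun measurableTypeR R >-> R}^nat) :
  continuous f -> (forall x, `|f x| <= M) -> (forall x, g n x @[n --> \oo] --> x) ->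
  \int[nu]_x f (g n x) @[n --> \oo] --> \int[nu]_x f x.
Proof.
move=> fc fM gx; have mf : measurable_fun setT f by exact: continuous_measurable_fun.
apply: (cvg_Rintegral_bounded (M := M)) => //.
- by move=> n; apply: (measurableT_comp (f := f) mf); exact: (@measurable_funPT _ _ _ _ (g n)).
- move=> x; exact: (@cvg_comp _ _ _ (fun n => g n x) f _ _ _ (gx x) (fc x)).
Qed.

(** Take the images of [nu] under simple functions converging to the identity.
    Dominated convergence applies because the kernel is continuous and bounded. *)
Lemma discretization : exists s : nat -> seq (R * R),
  (forall n, dprob (s n)) /\ forall z, 0 < complex.Im z ->
  complex.Re (dstieltjes (s n) z) @[n --> \oo] --> complex.Re (stieltjes nu z) /\
  complex.Im (dstieltjes (s n) z) @[n --> \oo] --> complex.Im (stieltjes nu z).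
Proof.
have mE : measurable_fun setT (EFin : measurableTypeR R -> \bar R).
  by apply/measurable_EFinP; exact: measurable_id.
have [g gE] := approximation_sfun measurableT mE.
have gx (x : R) : g n x @[n --> \oo] --> x by exact: (fine_cvg (gE x I)).
exists (fun n => sfun_law (g n)); split; first by move=> n; exact: dprob_sfun_law.
move=> z z0; have [kc [M kM]] := cbounded_kernel z0.
split.
- under eq_fun do rewrite Re_dstieltjes
    -(integral_sfun_law _ (fun x => complex.Re (1 / (z - x%:C)))).
  apply: (@cvg_Rintegral_sfun _ M) => // x; first by have [] := kc x.
  by rewrite (le_trans (ler_Re_modc _)).
- under eq_fun do rewrite Im_dstieltjes
    -(integral_sfun_law _ (fun x => complex.Im (1 / (z - x%:C)))).
  apply: (@cvg_Rintegral_sfun _ M) => // x; first by have [] := kc x.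
  by rewrite (le_trans (ler_Im_modc _)).
Qed.

End discretization.

(** * Riemann sums of monotone functions *)

Section riemann_sums.
Context (R : realType).
Notation mu := (@lebesgue_measure R).

Lemma integrable_bounded_itv (f : R -> R) (M a b : R) :
  measurable_fun setT f -> (forall x, `|f x| <= M) ->
  mu.-integrable `]a, b] (EFin \o f).
Proof.
move=> mf fM; apply: measurable_bounded_integrable => //.
- rewrite /= lebesgue_measure_itv /=; case: ifP => // _; by rewrite -EFinD ltry.
- exact: measurable_funTS.
- exists M; split; first exact: num_real.
  by move=> x Mx y _ /=; rewrite (le_trans (fM y))// ltW.
Qed.

Lemma Rintegral_itv_split (f : R -> R) (M a b c : R) : a <= b -> b <= c ->
  measurable_fun setT f -> (forall x, `|f x| <= M) ->
  \int[mu]_(x in `]a, c]) f x =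
  \int[mu]_(x in `]a, b]) f x + \int[mu]_(x in `]b, c]) f x.
Proof.
move=> ab bc mf fM.
rewrite -(@Rintegral_itvB R f (BRight a) (BRight c) b)//.
- by rewrite addrC subrK.
- exact: integrable_bounded_itv fM.
Qed.

Lemma Rintegral_itv_cst (r a b : R) : a <= b ->
  \int[mu]_(x in `]a, b]) r = r * (b - a).
Proof.
move=> ab; rewrite Rintegral_cst//= lebesgue_measure_itv /= lte_fin.
by case: ltP => // ba; rewrite (le_anti (introT andP (conj ab ba))) subrr.
Qed.

(** The bound is uniform over all monotone functions with values in [0, C]. It
    will replace dominated convergence in limits along an ultrafilter. *)
Lemma riemann_sum_le (g : R -> R) (C : R) (M : nat) :
  {homo g : x y / x <= y} -> (forall u, 0 <= g u <= C) -> (0 < M)%N ->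
  `|\int[mu]_(u in `]0, 1]) g u - (\sum_(k < M) g (k%:R / M%:R)) / M%:R| <= C / M%:R.
Proof.
move=> gnd gC M0.
have m0 : 0 < M%:R :> R by rewrite ltr0n.
have mg : measurable_fun setT g by exact: nondecreasing_measurable.
have gM x : `|g x| <= C by have /andP[g0 gc] := gC x; rewrite ger0_norm.
have key j : (\sum_(k < j) g (k%:R / M%:R)) / M%:R <= \int[mu]_(u in `]0, (j%:R / M%:R)]) g u
   <= (\sum_(k < j) g (k.+1%:R / M%:R)) / M%:R.
  elim: j => [|j /andP[IH1 IH2]].
    rewrite !big_ord0 !mul0r.
    by rewrite set_itvoc0 Rintegral_set0 lexx.
  have jle : j%:R / M%:R <= j.+1%:R / M%:R :> R by rewrite ler_pM2r ?invr_gt0// ler_nat.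
  have len : j.+1%:R / M%:R - j%:R / M%:R = M%:R^-1 :> R.
    by rewrite -mulrBl -natrB// subSnn mul1r.
  rewrite (@Rintegral_itv_split g C 0 (j%:R / M%:R))//.
  rewrite !big_ord_recr /= !mulrDl.
  have iu := @integrable_bounded_itv g C (j%:R / M%:R) (j.+1%:R / M%:R) mg gM.
  have ic (c : R) : mu.-integrable `](j%:R / M%:R), (j.+1%:R / M%:R)] (EFin \o (fun=> c)).
    by apply: (@integrable_bounded_itv _ `|c|).
  apply/andP; split; apply: lerD => //.
  - rewrite -[leLHS](_ : \int[mu]_(x in `](j%:R / M%:R), (j.+1%:R / M%:R)])
        g (j%:R / M%:R) = _); last first.
      by rewrite Rintegral_itv_cst// len.
    apply: le_Rintegral => //.
    by move=> u; rewrite /= in_itv /= => /andP[/ltW h _]; exact: gnd.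
  - rewrite -[leRHS](_ : \int[mu]_(x in `](j%:R / M%:R), (j.+1%:R / M%:R)])
        g (j.+1%:R / M%:R) = _); last first.
      by rewrite Rintegral_itv_cst// len.
    apply: le_Rintegral => //.
    by move=> u; rewrite /= in_itv /= => /andP[_ h]; exact: gnd.
have := key M; rewrite divff ?gt_eqF// => /andP[k1 k2].
rewrite ger0_norm ?subr_ge0// lerBlDr (le_trans k2)// -mulrDl ler_pM2r ?invr_gt0//.
have tel : \sum_(k < M) g (k.+1%:R / M%:R) =
    \sum_(k < M) g (k%:R / M%:R) + (g (M%:R / M%:R) - g (0%:R / M%:R)).
  rewrite -(telescope_sumr (fun k => g (k%:R / M%:R)) (leq0n M)) big_mkord -big_split /=.
  by apply: eq_bigr => k _; rewrite addrC subrK.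
rewrite tel addrC lerD2r.
by have /andP[_ h1] := gC (M%:R / M%:R); have /andP[h0 _] := gC (0%:R / M%:R); lra.
Qed.

End riemann_sums.

(** * Quantile functions *)

Section quantile.
Context (R : realType).
Notation mu := (@lebesgue_measure R).
Implicit Types (l s : seq (R * R)) (d o u : R).

Definition le_atom (p q : R * R) := p.1 <= q.1.

(** The interval starting at [o] is cut into pieces whose lengths are the
    weights, and the value on a piece is its atom. The default [d] stands for
    the atom preceding the list: it is the value to the right of the last piece. *)
Fixpoint step_fun d o l u : R :=
  if l is p :: l' then
    if u <= o + p.2 then p.1 else step_fun p.1 (o + p.2) l' u
  else d.

Lemma step_fun_ge (p : R * R) o l u : path le_atom p l -> p.1 <= step_fun p.1 o l u.
Proof.
elim: l p o => //= q l IH p o /andP[pq ql]; case: ifP => // _.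
by rewrite (le_trans pq)// IH.
Qed.

Lemma step_fun_homo (p : R * R) o l : path le_atom p l ->
  {homo step_fun p.1 o l : u v / u <= v}.
Proof.
elim: l p o => [p o _ u v //|q l IH p o /= /andP[pq ql] u v uv].
case: (leP u) => uo; case: (leP v) => vo //.
- exact: step_fun_ge.
- by move: (lt_le_trans uo (le_trans uv vo)); rewrite ltxx.
- exact: IH.
Qed.

Lemma measurable_step_fun (f : R -> R) d o l :
  measurable_fun setT (fun u => f (step_fun d o l u)).
Proof.
elim: l d o => //= p l IH d o.
rewrite (_ : (fun u => _) = (fun u => if u <= o + p.2 then f p.1 else
  f (step_fun p.1 (o + p.2) l u))); last by apply/funext => u; case: ifP.
apply: measurable_fun_ifT => //; apply: measurable_fun_ler => //.
Qed.

Lemma Rintegral_step_fun (f : R -> R) (M : R) d o l :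
  (forall x, `|f x| <= M) -> all (fun p => 0 <= p.2) l ->
  \int[mu]_(u in `]o, (o + \sum_(p <- l) p.2)]) f (step_fun d o l u) =
  \sum_(p <- l) p.2 * f p.1.
Proof.
move=> fM; elim: l d o => [|p l IH] d o /=.
  by rewrite !big_nil addr0 set_itvoc0 Rintegral_set0.
move=> /andP[p0 l0]; rewrite !big_cons.
have S0 : 0 <= \sum_(j <- l) j.2.
  by rewrite big_seq sumr_ge0// => q ql; move/allP: l0 => /(_ q ql).
rewrite (@Rintegral_itv_split _ _ M o (o + p.2)) ?lerDl//; last 2 first.
- by rewrite addrA lerDl.
- exact: (measurable_step_fun f d o (p :: l)).
congr (_ + _).
- rewrite (_ : Rintegral _ _ _ = \int[mu]_(u in `]o, (o + p.2)]) f p.1); last first.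
    apply: eq_Rintegral.
    by move=> u /set_mem; rewrite /= in_itv /= => /andP[_ ->].
  by rewrite Rintegral_itv_cst ?lerDl// addrAC subrr add0r mulrC.
- rewrite -(IH p.1 (o + p.2) l0) addrA; apply: eq_Rintegral => u /set_mem.
  by rewrite /= in_itv /= => /andP[h _]; rewrite leNgt h.
Qed.

(** Monotonicity of the quantile function requires the atoms to be sorted. *)
Definition quantile s := step_fun 0 0 (sort le_atom s).

Lemma quantile_homo s : {homo quantile s : u v / u <= v}.
Proof.
have : sorted le_atom (sort le_atom s).
  by apply: sort_sorted => p q; exact: le_total.
rewrite /quantile; case: (sort le_atom s) => [_ u v _|p l pl u v uv]; first exact: lexx.
have pp : path le_atom p (p :: l) by rewrite /= /le_atom lexx.
exact: (@step_fun_homo p 0 (p :: l) pp u v uv).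
Qed.

Lemma Rintegral_quantile (f : R -> R) (M : R) s : (forall x, `|f x| <= M) ->
  dprob s -> \int[mu]_(u in `]0, 1]) f (quantile s u) = \sum_(p <- s) p.2 * f p.1.
Proof.
move=> fM /andP[s0 /eqP s1].
have ps : perm_eq (sort le_atom s) s by rewrite perm_sort.
rewrite -(perm_big _ ps) -(Rintegral_step_fun 0 0 fM) ?(perm_all _ ps)//.
by rewrite (perm_big _ ps) s1 add0r.
Qed.

End quantile.

(** * Limits along an ultrafilter *)

Section ultra_limits.
Context (R : realType) (U : set_system nat) {UU : UltraFilter U}.
Notation mu := (@lebesgue_measure R).

(** The sequence has a cluster point by compactness, and for an ultrafilter a
    cluster point is a limit. *)
Lemma ultra_bounded_cvg (x : nat -> R) (y : R) :
  U [set n | `|x n| <= y] -> exists l : R, x @ U --> l.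
Proof.
move=> Uy.
have pU : ProperFilter (x @ U) by apply: fmap_proper_filter.
have xUy : (x @ U) `[- y, y]%classic.
  by rewrite /fmap /=; apply: filterS Uy => n /=; rewrite in_itv /= ler_norml.
have [l [_ cl]] := @segment_compact R (- y) y (x @ U) pU xUy.
exists l => B Bl.
have [//|nB] := in_ultra_setVsetC (x @^-1` B) UU.
have [w [wB wB']] := cl (~` B) B nB Bl.
by [].
Qed.

Lemma Rintegral_eq_unit (f g : R -> R) (M N : R) :
  measurable_fun setT f -> (forall x, `|f x| <= M) ->
  measurable_fun setT g -> (forall x, `|g x| <= N) ->
  (forall u, 0 < u < 1 -> f u = g u) ->
  \int[mu]_(u in `]0, 1]) f u = \int[mu]_(u in `]0, 1]) g u.
Proof.
move=> mf fM mg gM fg.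
have io (h : R -> R) (K : R) : measurable_fun setT h -> (forall x, `|h x| <= K) ->
    mu.-integrable `]0, 1[ (EFin \o h).
  move=> mh hK; apply: integrableS (integrable_bounded_itv 0 1 mh hK) => //.
  by apply: subset_itvl; rewrite bnd_simp.
rewrite -!Rintegral_itv_bndo_bndc; [|exact: io mg gM|exact: io mf fM].
apply: eq_Rintegral => u /set_mem; rewrite /= in_itv /=; exact: fg.
Qed.

Variables (X : nat -> R -> R) (Y : R -> R).
Hypothesis Xnd : forall n, {homo X n : u v / u <= v}.
Hypothesis XY : forall u, 0 < u < 1 -> X n u @[n --> U] --> Y u.

Let mX n : measurable_fun setT (X n).
Proof. by apply: nondecreasing_measurable => // u v; exact: Xnd. Qed.

Let Ynd u v : 0 < u -> u <= v -> v < 1 -> Y u <= Y v.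
Proof.
move=> u0 uv v1.
apply: (@ler_cvg_to _ U _ R (fun n => X n u) (fun n => X n v)).
- by apply: XY; rewrite u0 (le_lt_trans uv).
- by apply: XY; rewrite v1 (lt_le_trans u0).
- by apply: nearW => n; exact: Xnd.
Qed.

(** The pointwise limit [Y] is under control on ]0, 1[ only. *)
Definition unit_patch u := if 0 < u < 1 then Y u else 0.

Lemma measurable_unit_patch : measurable_fun setT unit_patch.
Proof.
rewrite (_ : unit_patch = Y \_ `]0, 1[); last first.
  by apply/funext => u; rewrite /unit_patch patchE mem_setE in_itv.
apply/measurable_restrict => //; rewrite setTI.
apply: (measurability (@RGenCInfty.G R)) => [|/= _ [_] [r] -> <-].
  exact: RGenCInfty.measurableE.
apply: is_interval_measurable => s t /= [].
rewrite /= !in_itv /= !andbT => /andP[s0 s1] rs [/andP[t0 t1] rt] u /andP[su ut].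
have u0 : 0 < u by exact: lt_le_trans su.
have u1 : u < 1 by exact: le_lt_trans t1.
by rewrite !in_itv /= u0 u1 andbT; split => //; rewrite (le_trans rs)// Ynd.
Qed.

Definition unit_cvg (f : R -> R) :=
  \int[mu]_(u in `]0, 1]) f (X n u) @[n --> U] --> \int[mu]_(u in `]0, 1]) f (unit_patch u).

(* Extended by its bounds 0 and [C] outside ]0, 1[, the composite of [phi] and [Z]
   is monotone on the whole line, as [riemann_sum_le] requires. *)
Let edge (phi Z : R -> R) (C u : R) :=
  if u <= 0 then 0 else if u < 1 then phi (Z u) else C.

Let edge_homo (phi Z : R -> R) C : {homo phi : x y / x <= y} ->
  (forall x, 0 <= phi x <= C) -> (forall u v, 0 < u -> u <= v -> v < 1 -> Z u <= Z v) ->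
  {homo edge phi Z C : u v / u <= v} /\ (forall u, 0 <= edge phi Z C u <= C).
Proof.
move=> pnd p0 Znd.
have C0 : 0 <= C by have /andP[h1 h2] := p0 0; exact: le_trans h2.
have eb u : 0 <= edge phi Z C u <= C.
  rewrite /edge; case: ifP => _; first by rewrite lexx.
  by case: ifP => _; [exact: p0|rewrite lexx andbT].
split => // u v uv; have /andP[ev0 evC] := eb v; have /andP[eu0 euC] := eb u.
rewrite {1}/edge; case: (leP u 0) => u0//.
have v0 := lt_le_trans u0 uv.
case: (ltP u 1) => u1; rewrite /edge (leNgt v 0) v0 /=.
- by case: (ltP v 1) => v1; [exact/pnd/Znd|have /andP[] := p0 (Z u)].
- by rewrite ltNge (le_trans u1 uv).
Qed.

(** Riemann sums are finite, so they converge along [U] with the values of [X].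
    They differ from the integrals by at most [C / M], whatever [n] is. *)
Lemma unit_cvg_monotone01 (phi : R -> R) C : continuous phi ->
  {homo phi : x y / x <= y} -> (forall x, 0 <= phi x <= C) -> unit_cvg phi.
Proof.
move=> pc pnd p0; rewrite /unit_cvg.
have mphi : measurable_fun setT phi by exact: continuous_measurable_fun.
have pC x : `|phi x| <= C by have /andP[h1 h2] := p0 x; rewrite ger0_norm.
have [/(_ _) Xh Xb] : (forall n, {homo edge phi (X n) C : u v / u <= v}) /\
    (forall n u, 0 <= edge phi (X n) C u <= C).
  by split => n; have [] := edge_homo pnd p0 (fun u v _ uv _ => Xnd n uv).
have [Yh Yb] := edge_homo pnd p0 Ynd.
have nb (g : R -> R) : (forall u, 0 <= g u <= C) -> forall u, `|g u| <= C.
  by move=> gb u; have /andP[h1 h2] := gb u; rewrite ger0_norm.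
have -> : \int[mu]_(u in `]0, 1]) phi (unit_patch u) =
    \int[mu]_(u in `]0, 1]) edge phi Y C u.
  apply: (@Rintegral_eq_unit _ _ C C) => //.
  - by apply: measurableT_comp => //; exact: measurable_unit_patch.
  - exact: nondecreasing_measurable.
  - exact: nb.
  - by move=> u /andP[u0 u1]; rewrite /unit_patch /edge u0 u1 (leNgt u 0) u0.
under eq_fun => n.
  rewrite (@Rintegral_eq_unit _ (edge phi (X n) C) C C); first over.
  - by apply: measurableT_comp => //.
  - by [].
  - by apply: nondecreasing_measurable => // u v; exact: Xh.
  - exact: nb (Xb n).
  - by move=> u /andP[u0 u1]; rewrite /edge u1 (leNgt u 0) u0.
have C0 : 0 <= C by have /andP[h1 h2] := p0 0; exact: le_trans h2.
apply/cvgrPdist_le => e e0.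
have [M [M0 Me]] : exists M : nat, (0 < M)%N /\ C / M%:R <= e / 3.
  have ce : 0 <= C / (e / 3) by rewrite divr_ge0// ltW// divr_gt0.
  exists (Num.bound (C / (e / 3))).+1; split => //.
  rewrite ler_pdivrMr ?ltr0n// mulrC -ler_pdivrMr ?divr_gt0//.
  by rewrite (le_trans (ltW (archi_boundP ce)))// ler_nat.
have Scvg : (\sum_(k < M) edge phi (X n) C (k%:R / M%:R)) / M%:R @[n --> U] -->
    (\sum_(k < M) edge phi Y C (k%:R / M%:R)) / M%:R.
  apply: cvgMl; apply: cvg_big => [|k _]; first exact: add_continuous.
  rewrite /edge.
  case: ifPn => k0; first exact: cvg_cst.
  case: ifPn => k1; last exact: cvg_cst.
  apply: (@cvg_comp _ _ _ (fun n => X n (k%:R / M%:R)) phi); last exact: pc.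
  by apply: XY; rewrite ltNge k0 k1.
have /cvgrPdist_le /(_ (e / 3)) := Scvg.
rewrite divr_gt0// => /(_ isT); apply: filterS => n.
have := riemann_sum_le (Xh n) (Xb n) M0; have := riemann_sum_le Yh Yb M0.
move: (\sum_(k < M) _) (\sum_(k < M) _) (\int[mu]_(u in _) _) (\int[mu]_(u in _) _).
move=> S1 S2 I1 I2; move: (S1 / _) (S2 / _) => A B.
rewrite !ler_norml => /andP[h1 h2] /andP[h3 h4] /andP[h5 h6].
by apply/andP; split; lra.
Qed.

Lemma unit_cvgB (f g : R -> R) M N : continuous f -> continuous g ->
  (forall x, `|f x| <= M) -> (forall x, `|g x| <= N) ->
  unit_cvg f -> unit_cvg g -> unit_cvg (f \- g).
Proof.
move=> fc gc fM gN cf cg; rewrite /unit_cvg.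
have mf : measurable_fun setT f by exact: continuous_measurable_fun.
have mg : measurable_fun setT g by exact: continuous_measurable_fun.
have E (Z : R -> R) : measurable_fun setT Z ->
    \int[mu]_(u in `]0, 1]) (f \- g) (Z u) =
    \int[mu]_(u in `]0, 1]) f (Z u) - \int[mu]_(u in `]0, 1]) g (Z u).
  move=> mZ; rewrite -RintegralB//.
  - apply: (integrable_bounded_itv (M := M) 0 1 (measurableT_comp mf mZ)) => u; exact: fM.
  - apply: (integrable_bounded_itv (M := N) 0 1 (measurableT_comp mg mZ)) => u; exact: gN.
rewrite E; last exact: measurable_unit_patch.
under eq_fun => n do rewrite (E _ (mX n)).
exact: cvgB.
Qed.

Lemma unit_cvg_cst r : unit_cvg (fun=> r).
Proof. exact: cvg_cst. Qed.

Lemma unit_cvg_monotone (phi : R -> R) M : continuous phi ->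
  {homo phi : x y / x <= y} -> (forall x, `|phi x| <= M) -> unit_cvg phi.
Proof.
move=> pc pnd pM.
have -> : phi = (fun x => phi x + M) \- (fun=> M) by apply/funext => x /=; rewrite addrK.
have pb x : 0 <= phi x + M <= M + M.
  by have := pM x; rewrite ler_norml => /andP[h1 h2]; apply/andP; split; lra.
have pMc : continuous (fun x => phi x + M).
  by move=> x; apply: cvgD => //; [exact: pc|exact: cvg_cst].
apply: (@unit_cvgB _ _ (M + M) `|M|) => //.
- by move=> x; exact: cvg_cst.
- by move=> x; have /andP[h1 h2] := pb x; rewrite ger0_norm.
- by apply: unit_cvg_monotone01 pMc _ pb => x y xy; rewrite lerD2r pnd.
- exact: unit_cvg_cst.
Qed.

End ultra_limits.

(** * Monotone decomposition of the Stieltjes kernel *)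

Section kernel_monotone_decomposition.
Context (R : realType).

Lemma is_derive_homo (f df : R -> R) : (forall x : R, is_derive x (1 : R) f (df x)) ->
  (forall x, 0 <= df x) -> {homo f : x y / x <= y}.
Proof.
move=> fd df0 x y xy.
apply: (@ger0_derive1_ndecr R f x y) => //.
- by move=> t _; rewrite derive1E (@derive_val _ _ _ _ _ _ _ (fd t)).
- apply: continuous_subspaceT => t; apply: differentiable_continuous.
  by apply/derivable1_diffP; exact: (@ex_derive _ _ _ _ _ _ _ (fd t)).
Qed.

Lemma one_add_sqr_gt0 (t : R) : 0 < 1 + t ^+ 2.
Proof. by rewrite ltr_pwDl ?sqr_ge0. Qed.

Lemma is_derive_inv_one_add_sqr (t : R) :
  is_derive t (1 : R) (fun x : R => (1 + x ^+ 2)^-1) (- (2 * t) / (1 + t ^+ 2) ^+ 2).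
Proof.
have n0 : 1 + t ^+ 2 != 0 by rewrite gt_eqF ?one_add_sqr_gt0.
have dn : is_derive t (1 : R) (fun x : R => 1 + x ^+ 2) (2 * t).
  apply: is_derive_eq (is_deriveD (is_derive_cst (1 : R) t (1 : R))
    (is_deriveM (is_derive_id t (1 : R)) (is_derive_id t (1 : R)))) _.
  by rewrite /GRing.scale /= mulr1 add0r mulrC mulr_natr mulr2n.
apply: is_derive_eq (@is_deriveV R (fun x => 1 + x ^+ 2) t (2 * t) 1 n0 dn) _.
by rewrite /GRing.scale /= mulNr mulrC -mulrN mulNr mulrN.
Qed.

Lemma atan_add_even_homo : {homo (fun t : R => atan t + (1 + t ^+ 2)^-1) : x y / x <= y}.
Proof.
apply: (is_derive_homo (df := fun t => (1 - t) ^+ 2 / (1 + t ^+ 2) ^+ 2)) => t; last first.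
  by rewrite divr_ge0 ?sqr_ge0.
have t0 := one_add_sqr_gt0 t.
have n0 : 1 + t ^+ 2 != 0 by rewrite gt_eqF.
apply: is_derive_eq (is_deriveD (is_derive1_atan t) (is_derive_inv_one_add_sqr t)) _.
by field.
Qed.

Lemma atan_add_odd_homo : {homo (fun t : R => atan t + t * (1 + t ^+ 2)^-1) : x y / x <= y}.
Proof.
apply: (is_derive_homo (df := fun t => 2 / (1 + t ^+ 2) ^+ 2)) => t; last first.
  by rewrite divr_ge0 ?sqr_ge0.
have t0 := one_add_sqr_gt0 t.
have n0 : 1 + t ^+ 2 != 0 by rewrite gt_eqF.
apply: is_derive_eq (is_deriveD (is_derive1_atan t)
  (is_deriveM (is_derive_id t (1 : R)) (is_derive_inv_one_add_sqr t))) _.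
by rewrite /GRing.scale /=; field.
Qed.


Definition bounded_monotone (f : R -> R) :=
  [/\ continuous f, {homo f : x y / x <= y} & exists M, forall x, `|f x| <= M].

(** A primitive of [1 / |z - x|^2], which is the modulus of the derivative of [1
    / (z - x)] in [x]. Subtracting either coordinate of the kernel from it
    leaves an increasing function, so each coordinate is a difference of two
    bounded increasing functions. *)
Definition atan_line (z : R[i]) (x : R) : R :=
  atan ((x - complex.Re z) / complex.Im z) / complex.Im z.

Section line.
Variable z : R[i].
Hypothesis z0 : 0 < complex.Im z.
Let y0 : complex.Im z != 0. Proof. by rewrite gt_eqF. Qed.

Let line_homo : {homo (fun x => (x - complex.Re z) / complex.Im z) : u v / u <= v}.
Proof. by move=> u v uv; rewrite ler_pM2r ?invr_gt0// lerD2r. Qed.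

Lemma bounded_monotone_atan_line : bounded_monotone (atan_line z).
Proof.
split.
- move=> x; apply: cvgMl.
  apply: (@cvg_comp _ _ _ (fun x => (x - complex.Re z) / complex.Im z) atan).
    by apply: cvgMl; apply: cvgD; [exact: cvg_id|exact: cvg_cst].
  exact: continuous_atan.
- by move=> u v uv; rewrite ler_pM2r ?invr_gt0// le_atan// line_homo.
- exists (pi / 2 / complex.Im z) => x.
  rewrite normrM normfV (gtr0_norm z0) ler_pM2r ?invr_gt0//.
  by rewrite ler_norml (ltW (atan_gtNpi2 _)) (ltW (atan_ltpi2 _)).
Qed.

Lemma atan_line_sub_Re_homo :
  {homo (fun x => atan_line z x - complex.Re (1 / (z - x%:C))) : u v / u <= v}.
Proof.
have E x : atan_line z x - complex.Re (1 / (z - x%:C)) =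
    (fun t => atan t + t * (1 + t ^+ 2)^-1) ((x - complex.Re z) / complex.Im z)
      / complex.Im z.
  rewrite /atan_line Re_kernel [RHS]mulrDl; congr (_ + _).
  have n1 := one_add_sqr_gt0 ((x - complex.Re z) / complex.Im z).
  have n2 : 0 < (complex.Re z - x) ^+ 2 + complex.Im z ^+ 2.
    by rewrite ltr_wpDl ?sqr_ge0// exprn_gt0.
  move: z0 y0 n1 n2; move: (complex.Re z) (complex.Im z) => a y yp yn n1 n2.
  by field; rewrite yn !gt_eqF// addrC -(opprB a) sqrrN.
by move=> u v uv /=; rewrite !E ler_pM2r ?invr_gt0// atan_add_odd_homo// line_homo.
Qed.

Lemma atan_line_sub_Im_homo :
  {homo (fun x => atan_line z x - complex.Im (1 / (z - x%:C))) : u v / u <= v}.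
Proof.
have E x : atan_line z x - complex.Im (1 / (z - x%:C)) =
    (fun t => atan t + (1 + t ^+ 2)^-1) ((x - complex.Re z) / complex.Im z)
      / complex.Im z.
  rewrite /atan_line Im_kernel opprK [RHS]mulrDl; congr (_ + _).
  have n1 := one_add_sqr_gt0 ((x - complex.Re z) / complex.Im z).
  have n2 : 0 < (complex.Re z - x) ^+ 2 + complex.Im z ^+ 2.
    by rewrite ltr_wpDl ?sqr_ge0// exprn_gt0.
  move: z0 y0 n1 n2; move: (complex.Re z) (complex.Im z) => a y yp yn n1 n2.
  by field; rewrite yn !gt_eqF// addrC -(opprB a) sqrrN.
by move=> u v uv /=; rewrite !E ler_pM2r ?invr_gt0// atan_add_even_homo// line_homo.
Qed.

End line.
End kernel_monotone_decomposition.

(** * Passage to the limit in the Stieltjes kernel *)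

Section kernel_limits.
Context (R : realType) (U : set_system nat) {UU : UltraFilter U}.
Variables (X : nat -> R -> R) (Y : R -> R).
Hypothesis Xnd : forall n, {homo X n : u v / u <= v}.
Hypothesis XY : forall u, 0 < u < 1 -> X n u @[n --> U] --> Y u.

Let unit_cvg_diff (p k : R -> R) K : bounded_monotone p -> continuous k ->
  (forall x, `|k x| <= K) -> {homo (fun x => p x - k x) : x y / x <= y} -> unit_cvg U X Y k.
Proof.
move=> [pc pnd [P pP]] kc kK qnd.
have -> : k = p \- (fun x => p x - k x) by apply/funext => x /=; rewrite subKr.
have qc : continuous (fun x => p x - k x) by move=> x; apply: cvgB; [exact: pc|exact: kc].
have qb x : `|p x - k x| <= P + K by rewrite (le_trans (ler_normB _ _))// lerD.
apply: (unit_cvgB Xnd XY pc qc pP qb).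
- exact: (unit_cvg_monotone Xnd XY pc pnd pP).
- exact: (unit_cvg_monotone Xnd XY qc qnd qb).
Qed.

Lemma unit_cvg_Re_kernel z : 0 < complex.Im z ->
  unit_cvg U X Y (fun x => complex.Re (1 / (z - x%:C))).
Proof.
move=> z0; have [kc [K kK]] := cbounded_kernel z0.
apply: (@unit_cvg_diff (atan_line z) _ K).
- exact: bounded_monotone_atan_line.
- by move=> x; have [] := kc x.
- by move=> x; rewrite (le_trans (ler_Re_modc _)).
- exact: atan_line_sub_Re_homo.
Qed.

Lemma unit_cvg_Im_kernel z : 0 < complex.Im z ->
  unit_cvg U X Y (fun x => complex.Im (1 / (z - x%:C))).
Proof.
move=> z0; have [kc [K kK]] := cbounded_kernel z0.
apply: (@unit_cvg_diff (atan_line z) _ K).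
- exact: bounded_monotone_atan_line.
- by move=> x; have [] := kc x.
- by move=> x; rewrite (le_trans (ler_Im_modc _)).
- exact: atan_line_sub_Im_homo.
Qed.

End kernel_limits.

Section uniform_image.
Context (R : realType) (phi : R -> R).
Hypothesis mphi : measurable_fun setT phi.
Notation mu := (@lebesgue_measure R).

Let unif : probability (measurableTypeR R) R := uniform_prob (@ltr01 R).

Let Z : {RV unif >-> measurableTypeR R} :=
  HB.pack (phi : measurableTypeR R -> measurableTypeR R)
    (isMeasurableFun.Build _ _ _ _ (phi : measurableTypeR R -> measurableTypeR R) mphi).

(** The law of [phi] composed with a uniform variable on [0, 1]; a quantile
    function is turned back into its law in this way. *)
Definition uniform_image : probability (measurableTypeR R) R := distribution unif Z.

Lemma Rintegral_uniform_image (f : R -> R) (M : R) :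
  measurable_fun setT f -> (forall x, `|f x| <= M) ->
  \int[uniform_image]_x f x = \int[mu]_(u in `]0, 1]) f (phi u).
Proof.
move=> mf fM.
have mfp : measurable_fun setT (fun u => f (phi u)) by exact: measurableT_comp.
have ifp : unif.-integrable setT (EFin \o (fun u => f (phi u))).
  by apply: (@integrable_bounded_prob _ unif _ M) => // u; exact: fM.
congr fine; rewrite integral_distribution//; last exact/measurable_EFinP.
rewrite (@integral_density _ _ _ mu unif (uniform_pdf 0 1))//; last first.
  apply/integrableP; split; first by apply/measurable_EFinP; exact: measurable_uniform_pdf.
  under eq_integral do rewrite gee0_abs ?lee_fin ?uniform_pdf_ge0//.
  by rewrite integral_uniform_pdf1// ltry.
rewrite integral_itv_obnd_cbnd; last first.
  by apply/measurable_EFinP; exact: measurable_funTS.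
rewrite [RHS]integral_mkcond; apply: eq_integral => x _ /=.
rewrite patchE mem_setE /uniform_pdf in_itv /= subr0 invr1.
by case: ifP => _; rewrite ?mule1 ?mule0.
Qed.

End uniform_image.

Section tail.
Context (R : realType).
Notation mu := (@lebesgue_measure R).

Lemma Rintegral_unit_ge (g : R -> R) (c a b : R) : 0 <= a -> a <= b -> b <= 1 ->
  measurable_fun setT g -> (forall x, 0 <= g x <= 1) ->
  (forall u, a < u <= b -> c <= g u) -> c * (b - a) <= \int[mu]_(u in `]0, 1]) g u.
Proof.
move=> a0 ab b1 mg g01 cg.
have gM x : `|g x| <= 1 by have /andP[g0 gc] := g01 x; rewrite ger0_norm.
have gp (A : set R) : 0 <= \int[mu]_(u in A) g u.
  by apply: Rintegral_ge0 => x _; have /andP[] := g01 x.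
rewrite (@Rintegral_itv_split _ g 1 0 a)//; last exact: le_trans ab b1.
rewrite (@Rintegral_itv_split _ g 1 a b)// ler_wpDl// ler_wpDr//.
rewrite -Rintegral_itv_cst//; apply: le_Rintegral => //.
- exact: (@integrable_bounded_itv _ (fun=> c) `|c|).
- exact: (integrable_bounded_itv (M := 1)).
Qed.

(** [1 + y Im G(iy)] is the integral of [x^2 / (x^2 + y^2)], which is at least
    1/2 where [|x| > y]. If the quantile function exceeds [y] in modulus at [u],
    then by monotonicity it does so on the whole of [u, 1] or on the whole of
    [0, u]. *)
Lemma quantile_tail (s : seq (R * R)) (u y : R) : dprob s -> 0 < u < 1 -> 0 < y ->
  y < `|quantile s u| ->
  Num.min u (1 - u) / 2 <= 1 + y * complex.Im (dstieltjes s (0 +i* y)).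
Proof.
move=> sP /andP[u0 u1] y0 yq.
pose r x := 1 + y * complex.Im (1 / ((0 +i* y) - x%:C)).
have y20 (x : R) : 0 < x ^+ 2 + y ^+ 2 by rewrite ltr_wpDl ?sqr_ge0// exprn_gt0.
have rE x : r x = x ^+ 2 / (x ^+ 2 + y ^+ 2).
  by rewrite /r Im_kernel /= sub0r sqrrN; field; rewrite gt_eqF.
have r01 x : 0 <= r x <= 1.
  rewrite rE divr_ge0 ?sqr_ge0 ?(ltW (y20 x))//= ler_pdivrMr// mul1r lerDl sqr_ge0//.
have rhalf x : y < `|x| -> 1 / 2 <= r x.
  move=> yx; rewrite rE ler_pdivlMr//.
  have : y ^+ 2 <= x ^+ 2 by rewrite -[x ^+ 2]real_normK ?num_real// lerXn2r ?nnegrE// ltW.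
  by lra.
have y0' : 0 < complex.Im (0 +i* y) by [].
have mr : measurable_fun setT r.
  apply: measurable_funD => //; apply: measurable_funM => //.
  by have [kc _] := cbounded_kernel y0'; exact: measurable_Im_ccont kc.
have rM x : `|r x| <= 1 by have /andP[h1 h2] := r01 x; rewrite ger0_norm.
have mq : measurable_fun setT (quantile s).
  by apply: nondecreasing_measurable => // v w; exact: quantile_homo.
have -> : 1 + y * complex.Im (dstieltjes s (0 +i* y)) =
    \int[mu]_(v in `]0, 1]) r (quantile s v).
  rewrite (Rintegral_quantile rM sP) Im_dstieltjes -(dprob_sum sP) mulr_sumr -big_split.
  by apply: eq_bigr => p _; rewrite /r [RHS]mulrDr mulr1 [in RHS]mulrCA.
have mrq : measurable_fun setT (fun v => r (quantile s v)) by exact: measurableT_comp.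
have min1 : Num.min u (1 - u) <= 1 - u by rewrite ge_min lexx orbT.
have min0 : Num.min u (1 - u) <= u by rewrite ge_min lexx.
have [q0|q0] := leP 0 (quantile s u).
- rewrite ger0_norm// in yq.
  apply: le_trans (@Rintegral_unit_ge (fun v => r (quantile s v)) (1 / 2) u 1 _ _ _ mrq _ _) => //.
  + by lra.
  + exact: ltW.
  + exact: ltW.
  + move=> v /andP[uv _]; apply: rhalf; apply: lt_le_trans yq _.
    by rewrite (le_trans _ (ler_norm _))// quantile_homo// ltW.
- rewrite ltr0_norm// in yq.
  apply: le_trans (@Rintegral_unit_ge (fun v => r (quantile s v)) (1 / 2) 0 u _ _ _ mrq _ _) => //.
  + by lra.
  + exact: ltW.
  + exact: ltW.
  + move=> v /andP[_ vu]; apply: rhalf; apply: lt_le_trans yq _.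
    by rewrite -normrN (le_trans _ (ler_norm _))// lerN2 quantile_homo.
Qed.

End tail.

(** * Compactness *)

Section compactness.
Context (R : realType) (s : nat -> seq (R * R)) (T : R[i] -> R[i]).
Hypothesis sP : forall n, dprob (s n).
Hypothesis sRe : forall z, 0 < complex.Im z ->
  complex.Re (dstieltjes (s n) z) @[n --> \oo] --> complex.Re (T z).
Hypothesis sIm : forall z, 0 < complex.Im z ->
  complex.Im (dstieltjes (s n) z) @[n --> \oo] --> complex.Im (T z).
(* By [quantile_tail], the left side controls the mass that lies beyond [y]. *)
Hypothesis tight : forall e : R, 0 < e ->
  exists2 y, 0 < y & 1 + y * complex.Im (T (0 +i* y)) < e.
Notation mu := (@lebesgue_measure R).

Let X n := quantile (s n).

Let X_bounded u : 0 < u < 1 -> exists y, \forall n \near \oo, `|X n u| <= y.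
Proof.
move=> /andP[u0 u1].
have m0 : 0 < Num.min u (1 - u) / 2 by rewrite divr_gt0// lt_min u0 subr_gt0.
have [y y0 ye] := tight m0; exists y.
have y0' : 0 < complex.Im (0 +i* y) by [].
have : 1 + y * complex.Im (dstieltjes (s n) (0 +i* y)) @[n --> \oo] -->
    1 + y * complex.Im (T (0 +i* y)).
  by apply: cvgD; [exact: cvg_cst|apply: cvgMr; exact: sIm].
move=> /cvgr_lt /(_ _ ye); apply: filterS => n; rewrite leNgt; apply: contraTN => yX.
by rewrite -leNgt; apply: quantile_tail yX => //; rewrite u0.
Qed.

(** Helly's theorem. By tightness and [quantile_tail], the quantile functions
    are eventually bounded at each point of ]0, 1[; so they converge pointwise
    along an ultrafilter containing the neighbourhoods of infinity. Integrals of
    the kernel follow, by [unit_cvg_Re_kernel] and [unit_cvg_Im_kernel]. *)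
Lemma stieltjes_compactness : exists rho : probability (measurableTypeR R) R,
  forall z, 0 < complex.Im z -> stieltjes rho z = T z.
Proof.
have [U [UU oU]] := ultraFilterLemma (eventually_filter : ProperFilter \oo).
have Xnd n : {homo X n : u v / u <= v} by move=> u v; exact: quantile_homo.
have : forall u, exists l : R, 0 < u < 1 -> X n u @[n --> U] --> l.
  move=> u; have [u01|] := boolP (0 < u < 1); last by exists 0.
  have [y Xy] := X_bounded u01.
  by have [l Xl] := @ultra_bounded_cvg _ _ _ (X ^~ u) y (oU _ Xy); exists l.
move=> /choice[Y XY].
have mZ : measurable_fun setT (unit_patch Y) by exact: measurable_unit_patch Xnd XY.
exists (uniform_image mZ) => z z0.
have [kc [K kK]] := cbounded_kernel z0.
have Re_le x : `|complex.Re (1 / (z - x%:C))| <= K by rewrite (le_trans (ler_Re_modc _)).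
have Im_le x : `|complex.Im (1 / (z - x%:C))| <= K by rewrite (le_trans (ler_Im_modc _)).
have ReE : complex.Re (stieltjes (uniform_image mZ) z) = complex.Re (T z).
  rewrite [LHS](Rintegral_uniform_image mZ (measurable_Re_ccont kc) Re_le).
  apply: (@cvg_unique _ (@Rhausdorff R) _ _ _ _ (unit_cvg_Re_kernel Xnd XY z0)).
  have E n : \int[mu]_(u in `]0, 1]) complex.Re (1 / (z - (X n u)%:C)) =
      complex.Re (dstieltjes (s n) z).
    by rewrite Re_dstieltjes; exact: Rintegral_quantile Re_le (sP n).
  rewrite /= (funext E).
  by apply: cvg_trans (sRe z0) => A hA; exact: oU.
have ImE : complex.Im (stieltjes (uniform_image mZ) z) = complex.Im (T z).
  rewrite [LHS](Rintegral_uniform_image mZ (measurable_Im_ccont kc) Im_le).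
  apply: (@cvg_unique _ (@Rhausdorff R) _ _ _ _ (unit_cvg_Im_kernel Xnd XY z0)).
  have E n : \int[mu]_(u in `]0, 1]) complex.Im (1 / (z - (X n u)%:C)) =
      complex.Im (dstieltjes (s n) z).
    by rewrite Im_dstieltjes; exact: Rintegral_quantile Im_le (sP n).
  rewrite /= (funext E).
  by apply: cvg_trans (sIm z0) => A hA; exact: oU.
by apply/eqP; rewrite eq_complex ReE ImE !eqxx.
Qed.

End compactness.

(** * The square root of z G(z) *)

Section geometric_mean.
Context (R : realType).
Implicit Types z w : R[i].

(** For [Im z > 0 > Im w], the square root of [z w] with positive real part
    ([Re_gmean_gt0]). *)
Definition gmean z w := cpow z (1 / 2) * cpow w (1 / 2).

Lemma gmean_sqr z w : z != 0 -> w != 0 -> gmean z w ^+ 2 = z * w.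
Proof. by move=> z0 w0; rewrite exprMn !cpow_half_sqr. Qed.

Lemma Im_neq0 z : complex.Im z != 0 -> z != 0.
Proof. by apply: contraNN => /eqP ->. Qed.

Lemma Re_gmean_gt0 z w : 0 < complex.Im z -> complex.Im w < 0 ->
  0 < complex.Re (gmean z w).
Proof.
move=> z0 w0; have zn : z != 0 by rewrite Im_neq0// gt_eqF.
have wn : w != 0 by rewrite Im_neq0// lt_eqF.
have /andP[z1 z2] := carg_Im_gt0 z0; have /andP[w1 w2] := carg_Im_lt0 w0.
rewrite /gmean !cpowE mulrACA -cisD -rmorphM /=.
rewrite mul0r subr0 mulr_gt0//.
  by rewrite mulr_gt0// powR_gt0// modc_gt0.
by apply: cos_gt0_pihalf; apply/andP; split; lra.
Qed.

Lemma gmean_quot z w : z != 0 -> gmean z w / z = cpow w (1 / 2) / cpow z (1 / 2).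
Proof.
move=> z0; rewrite /gmean -{2}(cpow_half_sqr z0) expr2.
have := cpow_neq0 (1 / 2) z0; move: (cpow z _) (cpow w _) => a b a0.
by rewrite invfM mulrACA divff// mul1r.
Qed.

End geometric_mean.

Section complex_limits.
Context (R : realType).
Implicit Types (u : nat -> R[i]) (l : R[i]).


Lemma modc_le_Re_Im (z : R[i]) : modc z <= `|complex.Re z| + `|complex.Im z|.
Proof.
rewrite -(ler_pXn2r (_ : (0 < 2)%N))// ?nnegrE ?modc_ge0 ?addr_ge0//.
rewrite sqr_modc sqrrD !real_normK ?num_real//.
by rewrite -addrA lerD2l lerDr mulrn_wge0// mulr_ge0.
Qed.

Lemma cvg_modc0 u l :
  complex.Re (u n) @[n --> \oo] --> complex.Re l ->
  complex.Im (u n) @[n --> \oo] --> complex.Im l ->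
  modc (u n - l) @[n --> \oo] --> (0 : R).
Proof.
move=> uRe uIm.
have h : `|complex.Re (u n) - complex.Re l| + `|complex.Im (u n) - complex.Im l|
    @[n --> \oo] --> (0 : R).
  rewrite -[X in _ --> X]addr0; apply: cvgD.
  - rewrite -(normr0 R) -(subrr (complex.Re l)); apply: cvg_norm.
    by apply: cvgB => //; exact: cvg_cst.
  - rewrite -(normr0 R) -(subrr (complex.Im l)); apply: cvg_norm.
    by apply: cvgB => //; exact: cvg_cst.
apply: squeeze_cvgr (cvg_cst _) h; apply: nearW => n.
rewrite modc_ge0 (le_trans (modc_le_Re_Im _))//.
by case: (u n) (l) => a b [c d].
Qed.

Lemma modc0_cvg u l : modc (u n - l) @[n --> \oo] --> (0 : R) ->
  complex.Re (u n) @[n --> \oo] --> complex.Re l /\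
  complex.Im (u n) @[n --> \oo] --> complex.Im l.
Proof.
move=> ul.
have H (a b : nat -> R) (c : R) : (forall n, `|a n - c| <= b n) ->
    b n @[n --> \oo] --> (0 : R) -> a n @[n --> \oo] --> c.
  move=> ab b0; apply/cvgrPdist_le => e e0.
  have /cvgr_le /(_ _ e0) := b0; apply: filterS => n be.
  by rewrite distrC (le_trans (ab n)).
split; apply: (H _ _ _ _ ul) => n.
- apply: le_trans (ler_Re_modc _); by case: (u n) (l) => a b [c d].
- apply: le_trans (ler_Im_modc _); by case: (u n) (l) => a b [c d].
Qed.

End complex_limits.

Section stieltjes_infinity.
Context (R : realType) (nu : probability (measurableTypeR R) R).

Let quot_bound (x y : R) : 0 < y -> `|x * y / (x ^+ 2 + y ^+ 2)| <= 1 /\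
  `|x * y / (x ^+ 2 + y ^+ 2)| <= `|x| / y /\
  `|y ^+ 2 / (x ^+ 2 + y ^+ 2) - 1| <= `|x| / y.
Proof.
move=> y0; have d0 : 0 < x ^+ 2 + y ^+ 2 by rewrite ltr_wpDl ?sqr_ge0// exprn_gt0.
have h : `|x| ^+ 2 = x ^+ 2 by rewrite real_normK// num_real.
have x0 := normr_ge0 x.
have E : y ^+ 2 / (x ^+ 2 + y ^+ 2) - 1 = - (x ^+ 2 / (x ^+ 2 + y ^+ 2)).
  by field; rewrite gt_eqF.
rewrite E normrN (ger0_norm (_ : 0 <= x ^+ 2 / _)) ?divr_ge0 ?sqr_ge0 ?(ltW d0)//.
rewrite (normrM (x * y)) (normrM x) normfV (gtr0_norm d0) (gtr0_norm y0).
move: d0 h x0; move: (`|x|) (x ^+ 2) => t x2 + h; rewrite -h => d0 t0.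
have sq := sqr_ge0 (t - y); have ty : 0 <= t * y by rewrite mulr_ge0// ltW.
have tt : 0 <= t * t * t by rewrite !mulr_ge0.
split; first by rewrite ler_pdivrMr//; nra.
by split; rewrite ler_pdivrMr// mulrAC ler_pdivlMr//; nra.
Qed.

(** The integrand [iy / (iy - x)] is bounded by 1 and tends to 1. *)
Lemma stieltjes_at_infinity :
  modc ((0 +i* n.+1%:R) * stieltjes nu (0 +i* n.+1%:R) - 1) @[n --> \oo] --> (0 : R).
Proof.
pose z n : R[i] := 0 +i* n.+1%:R.
have y0 n : 0 < n.+1%:R :> R by rewrite ltr0n.
have z0 n : 0 < complex.Im (z n) by rewrite /=.
have inv0 (x : R) : `|x| / n.+1%:R @[n --> \oo] --> (0 : R).
  rewrite -(mulr0 `|x|); apply: cvgMr; exact: cvg_harmonic.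
have zRe (y : R) w : complex.Re ((0 +i* y) * w) = - y * complex.Im w.
  by case: w => c d /=; rewrite mul0r add0r mulNr.
have zIm (y : R) w : complex.Im ((0 +i* y) * w) = y * complex.Re w.
  by case: w => c d /=; rewrite mul0r add0r.
have kRe (y x : R) : complex.Re (1 / ((0 +i* y) - x%:C)) = - x / (x ^+ 2 + y ^+ 2).
  by rewrite Re_kernel /= sub0r sqrrN.
have kIm (y x : R) : complex.Im (1 / ((0 +i* y) - x%:C)) = - (y / (x ^+ 2 + y ^+ 2)).
  by rewrite Im_kernel /= sub0r sqrrN.
have ReE n : complex.Re (z n * stieltjes nu (z n)) =
    \int[nu]_x (n.+1%:R ^+ 2 / (x ^+ 2 + n.+1%:R ^+ 2)).
  have ii := integrable_Im_cbounded nu (cbounded_kernel (z0 n)).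
  rewrite zRe -[complex.Im _]/(Rintegral _ _ _) -RintegralZl//.
  by apply: eq_Rintegral => x _; rewrite kIm mulrN mulNr opprK mulrA expr2.
have ImE n : complex.Im (z n * stieltjes nu (z n)) =
    \int[nu]_x (- (x * n.+1%:R / (x ^+ 2 + n.+1%:R ^+ 2))).
  have ii := integrable_Re_cbounded nu (cbounded_kernel (z0 n)).
  rewrite zIm -[complex.Re _]/(Rintegral _ _ _) -RintegralZl//.
  by apply: eq_Rintegral => x _; rewrite kRe mulNr mulrN mulrCA mulrA.
have zkm n : measurable_fun setT (fun x : R => (x ^+ 2 + n.+1%:R ^+ 2)^-1).
  apply: continuous_measurable_fun => x.
  apply: cvgV; first by rewrite gt_eqF// ltr_wpDl ?sqr_ge0// exprn_gt0.
  by apply: cvgD; [exact: exprn_continuous|exact: cvg_cst].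
apply: cvg_modc0.
- rewrite (funext ReE).
  have -> : complex.Re (1 : R[i]) = \int[nu]_x 1.
    by rewrite Rintegral_cst// mul1r [X in fine X](probability_setT nu).
  apply: (cvg_Rintegral_bounded (M := 1)) => //.
  + by move=> n; apply: measurable_funM.
  + move=> n x; have d0 : 0 < x ^+ 2 + n.+1%:R ^+ 2 :> R by rewrite ltr_wpDl ?sqr_ge0// exprn_gt0.
    by rewrite ger0_norm ?divr_ge0 ?sqr_ge0 ?(ltW d0)// ler_pdivrMr// mul1r lerDr sqr_ge0.
  + by move=> x; rewrite normr1.
  + move=> x; apply/cvgrPdist_le => e e0.
    have /cvgr_le /(_ _ e0) := inv0 x; apply: filterS => n xe.
    by rewrite distrC (le_trans _ xe)//; have [_ []] := quot_bound x (y0 n).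
- rewrite (funext ImE).
  have -> : complex.Im (1 : R[i]) = \int[nu]_x 0 by rewrite Rintegral_cst// mul0r.
  apply: (cvg_Rintegral_bounded (M := 1)) => //.
  + by move=> n; apply: measurableT_comp => //; do 2 apply: measurable_funM => //.
  + by move=> n x; rewrite normrN; have [] := quot_bound x (y0 n).
  + by move=> x; rewrite normr0.
  + move=> x; apply/cvgrPdist_le => e e0.
    have /cvgr_le /(_ _ e0) := inv0 x; apply: filterS => n xe.
    by rewrite sub0r opprK (le_trans _ xe)//; have [_ []] := quot_bound x (y0 n).
Qed.

End stieltjes_infinity.

(** The approximants are the Chebyshev means of order [n] of the Boolean powers of
    the n-th discretization of [nu]; their transforms tend to [gmean z (G z) / z].
    For the tightness, the square of [iy T(iy)] is [iy G(iy)], which tends to 1; as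
    [iy T(iy)] has positive real part, it tends to 1 too, by [modc_sqrt_dist], and
    its real part is [- y Im T(iy)]. *)
Lemma stieltjes_gmean (R : realType) (nu : probability (measurableTypeR R) R) :
  exists rho : probability (measurableTypeR R) R, forall z : R[i], 0 < complex.Im z ->
    stieltjes rho z = cpow (stieltjes nu z) (1 / 2) / cpow z (1 / 2).
Proof.
have [s [sP sG]] := discretization nu.
have : forall n, exists s', dprob s' /\ forall z : R[i], 0 < complex.Im z ->
    dstieltjes s' z = cheb_mean n (z * dstieltjes (s n) z) / z.
  by move=> n; have [s' ? ?] := cheb_mean_dstieltjes n (sP n); exists s'.
move=> /choice[s' s'E].
pose T z := cpow (stieltjes nu z) (1 / 2) / cpow z (1 / 2).
have zn (z : R[i]) : 0 < complex.Im z -> z != 0 by move=> z0; rewrite Im_neq0// gt_eqF.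
have Gn z : 0 < complex.Im z -> stieltjes nu z != 0.
  by move=> z0; rewrite Im_neq0// lt_eqF// Im_stieltjes_lt0.
have sn n z : 0 < complex.Im z -> dstieltjes (s n) z != 0.
  by move=> z0; rewrite Im_neq0// lt_eqF// Im_dstieltjes_lt0.
have TE z : 0 < complex.Im z -> T z = gmean z (stieltjes nu z) / z.
  by move=> z0; rewrite gmean_quot ?zn.
have s'T z : 0 < complex.Im z -> modc (dstieltjes (s' n) z - T z) @[n --> \oo] --> (0 : R).
  move=> z0.
  have Rg : 0 < complex.Re (gmean z (stieltjes nu z)).
    by apply: Re_gmean_gt0 => //; exact: Im_stieltjes_lt0.
  have Rs n : 0 < complex.Re (gmean z (dstieltjes (s n) z)).
    by apply: Re_gmean_gt0 => //; exact: Im_dstieltjes_lt0.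
  have dG : modc (dstieltjes (s n) z - stieltjes nu z) @[n --> \oo] --> (0 : R).
    by have [] := sG _ z0; exact: cvg_modc0.
  have sq : modc (gmean z (dstieltjes (s n) z) ^+ 2 - gmean z (stieltjes nu z) ^+ 2)
      @[n --> \oo] --> (0 : R).
    rewrite -(mulr0 (modc z)).
    rewrite (_ : (fun n => _) =
        (fun n => modc z * modc (dstieltjes (s n) z - stieltjes nu z))).
      exact: cvgMr.
    apply/funext => n.
    by rewrite (gmean_sqr (zn _ z0) (sn n _ z0)) (gmean_sqr (zn _ z0) (Gn _ z0)) -mulrBr modcM.
  rewrite -(mul0r (modc z)^-1) (_ : (fun n => _) = (fun n =>
      modc (cheb_mean n (gmean z (dstieltjes (s n) z) ^+ 2) - gmean z (stieltjes nu z))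
      / modc z)).
    by apply: cvgMl; exact: cheb_mean_cvg Rg Rs sq.
  apply/funext => n; have [_ ->//] := s'E n.
  by rewrite TE// -mulrBl modcM modcV (gmean_sqr (zn _ z0) (sn n _ z0)).
apply: (@stieltjes_compactness R s' T).
- by move=> n; have [] := s'E n.
- by move=> z z0; have [] := modc0_cvg (s'T z z0).
- by move=> z z0; have [] := modc0_cvg (s'T z z0).
move=> e e0.
have [y yp ye] : exists2 y : R, 0 < y &
    modc ((0 +i* y) * stieltjes nu (0 +i* y) - 1) < e.
  have /cvgr_lt /(_ _ e0) [N _ /(_ N (leqnn N)) h] := stieltjes_at_infinity nu.
  by exists N.+1%:R; first by rewrite ltr0n.
exists y => //; apply: le_lt_trans ye; have y0 : 0 < complex.Im (0 +i* y) by [].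
have Rg : 0 < complex.Re (gmean (0 +i* y) (stieltjes nu (0 +i* y))).
  by apply: Re_gmean_gt0 => //; exact: Im_stieltjes_lt0.
have R1 : 0 < complex.Re (1 : R[i]) by [].
have := modc_sqrt_dist R1 Rg.
rewrite (gmean_sqr (zn _ y0) (Gn _ y0)) expr1n divr1.
apply: le_trans.
have gE : gmean (0 +i* y) (stieltjes nu (0 +i* y)) = (0 +i* y) * T (0 +i* y).
  by rewrite TE// mulrC divfK ?zn.
rewrite gE -modcN opprB; apply: le_trans (ler_Re_modc _); apply: le_trans (ler_norm _).
by case: (T _) => a b /=; rewrite mul0r sub0r opprK.
Qed.

Theorem mainTheorem6 (R : realType) (nu : probability (measurableTypeR R) R) :
  exists nut : probability (measurableTypeR R) R,
    (forall z : R[i], 0 < complex.Im z ->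
       stieltjes nut z = cpow (stieltjes nu z) (1 / 2) / cpow z (1 / 2)) /\
    (forall (lambda : R) (mu : probability (measurableTypeR R) R),
       0 < lambda ->
       mu `[-1, 1]%classic = 1%E ->
       (forall z : R[i], 0 < complex.Im z ->
          cintegral mu (fun x => 1 / cpow (z - x%:C) (lambda / 2))
          = cpow (stieltjes nu z) (lambda / 2)) ->
       forall z : R[i], 0 < complex.Im z ->
         cintegral (mconv (kappa lambda) mu)
                   (fun x => 1 / cpow (z - x%:C) lambda)
         = cpow (cpow (stieltjes nu z) (1 / 2) / cpow z (1 / 2)) lambda /\
         cpow (cpow (stieltjes nu z) (1 / 2) / cpow z (1 / 2)) lambda
         = cpow (stieltjes nut z) lambda).
Proof.
have [nut nutE] := stieltjes_gmean nu; exists nut; split => //.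
move=> lambda mu lambda0 _ muE z z0; rewrite nutE//; split => //.
have zn : z != 0 by rewrite Im_neq0// gt_eqF.
have G0 := Im_stieltjes_lt0 z0 nu.
have Gn : stieltjes nu z != 0 by rewrite Im_neq0// lt_eqF.
rewrite cintegral_mconv_kappa// muE// cpowN// cpow_quot//.
- by rewrite (_ : 1 / 2 * lambda = lambda / 2) 1?mulrC// div1r mulrC.
- have /andP[g1 g2] := carg_Im_lt0 G0; have /andP[h1 h2] := carg_Im_gt0 z0.
  by apply/andP; split; lra.
Qed.
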